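(* Let $\ell\in\mathbb{Z}$ and $A,B\in\mathbb{C}$ with $B\neq 0,1$, and suppose $A,B$ are such that no division by zero occurs, i.e. $f_\ell(A,B;k)=\frac{(A+Bk+1)_{\ell-1}}{(A+1)_{\ell-1}}$ is well defined for all integers $k\ge 0$ (if $\ell\ge1$: $(A+1)_{\ell-1}\ne0$; if $\ell\le 0$: $(A+Bk+\ell)_{1-\ell}\neq0$ for all $k\ge0$). Then there is a rational function $F_\ell(A,B;y)$ of $y$, with coefficients polynomial in $A,B$, such that $$y^A\,F_\ell(A,B;y)=1+\sum_{k=1}^\infty \frac{(A+Bk+1)_{\ell-1}}{(A+1)_{\ell-1}}\binom{A+Bk}{k}z^k$$ holds for $z$ in a neighborhood of $0$, where $y$ near $1$ is the solution of $y-1-z\,y^B=0$. Specifically, $$F_\ell(A,B;y)=\sum_{r=0}^\infty \hat f_\ell(A,B;r)\left(\frac{1-y}{y}\right)^r .$$ Moreover, $F_\ell$ has at most one pole on $\mathbb{P}^1_y$. If $\ell=-m<0$, the pole is at $y=0$ and is of order $m$; if $\ell>0$, it is at $y=B/(B-1)$ and is of order $2\ell-1$. If $\ell>0$, $F_\ell$ can be written as $(y^2D_y)^{\ell-1}\tilde F_\ell$, where $D_y=d/dy$ and $\tilde F_\ell$ is a rational function of $y$ with a pole at $y=B/(B-1)$ of order $\ell$.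
   Context: Notation: for $c\in\mathbb{C}$, $(c)_r=c(c+1)\cdots(c+r-1)$ for integers $r\ge0$ and $(c)_{-s}=[(c-s)\cdots(c-1)]^{-1}$ for integers $s\ge0$; $\binom{c}{r}=(c-r+1)_r/r!$ for integers $r\ge0$. For each $\ell\in\mathbb{Z}$ and integer $k\ge 0$, $f_\ell(A,B;k)=\frac{(A+Bk+1)_{\ell-1}}{(A+1)_{\ell-1}}=\frac{(A+\ell)_{1-\ell}}{(A+Bk+\ell)_{1-\ell}}$, and $$\hat f_\ell(A,B;r)=\sum_{k=0}^r(-1)^k\binom{r}{k}\binom{A+Bk}{r}f_\ell(A,B;k),\qquad r\ge0 .$$ Powers $y^A$, $y^B$ near $y=1$ are principal branches. *)

(* Defs.v *)
From HB Require Import structures.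
From mathcomp Require Import all_boot all_order all_algebra.
From mathcomp Require Import complex.
From mathcomp Require Import all_classical all_reals all_analysis.

Set Implicit Arguments.
Unset Strict Implicit.
Unset Printing Implicit Defensive.

Import Order.TTheory GRing.Theory Num.Theory numFieldNormedType.Exports.

Local Open Scope classical_set_scope.
Local Open Scope ring_scope.
Local Open Scope complex_scope.

(* The complex numbers, as a structure rather than as the type [R[i]]: the
   norm topology that the library puts on every [numClosedFieldType] is then
   found on them, which it is not on [R[i]]. *)
Definition Cplx (R : realType) : numClosedFieldType := R[i].

Section ComplexPower.
Variable R : realType.
Implicit Types z : Cplx R.

Definition cre z : R := complex.Re (z : R[i]).
Definition cim z : R := complex.Im (z : R[i]).

Definition cmod z : R := Num.sqrt (cre z ^+ 2 + cim z ^+ 2).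

(* Values in ]-pi, pi] for [z != 0]. *)
Definition carg z : R :=
  let t := acos (cre z / cmod z) in if 0 <= cim z then t else - t.

Definition cexp z : Cplx R :=
  (expR (cre z) * cos (cim z)) +i* (expR (cre z) * sin (cim z)).

Definition clog z : Cplx R := ln (cmod z) +i* carg z.

(* [y ^ A], principal branch; meant for [y != 0]. *)
Definition cpow (y A : Cplx R) : Cplx R := cexp (A * clog y).

End ComplexPower.

Section Coefficients.
Variable R : realType.
Implicit Types (c A B : Cplx R) (l : int) (r k : nat).

Definition rising c r : Cplx R := \prod_(i < r) (c + i%:R).

(* [(c)_n] for an integer [n]; [Negz s] is [- s.+1]. *)
Definition poch c (n : int) : Cplx R :=
  match n with
  | Posz r => rising c r
  | Negz s => (rising (c - s.+1%:R) s.+1)^-1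
  end.

Definition cbin c r : Cplx R := rising (c - r%:R + 1) r / r`!%:R.

Definition fl l A B k : Cplx R :=
  poch (A + B * k%:R + 1) (l - 1) / poch (A + 1) (l - 1).

(* Division is total here, so [fl] always has a value; this says that no
   denominator in it vanishes. *)
Definition fl_defined l A B : Prop :=
  (1 <= l -> poch (A + 1) (l - 1) != 0) /\
  (l <= 0 -> forall k, poch (A + B * k%:R + l%:~R) (1 - l) != 0).

Definition fhat l A B r : Cplx R :=
  \sum_(k < r.+1) (-1) ^+ k * 'C(r, k)%:R * cbin (A + B * k%:R) r
                  * fl l A B k.

(* [Y] is the branch near [1] of the solution [y] of [y - 1 - z y ^ B = 0],
   for [z] near [0]. *)
Definition solution_near1 B (Y : Cplx R -> Cplx R) : Prop :=
  Y z @[z --> (0 : Cplx R)] --> (1 : Cplx R) /\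
  exists2 U : set (Cplx R), nbhs (1 : Cplx R) U &
    \forall z \near (0 : Cplx R), forall y, U y ->
      (y - 1 - z * cpow y B = 0 <-> y = Y z).

End Coefficients.

Section RationalFunctions.
Variable K : fieldType.
Implicit Type F : {fraction {poly K}}.

(* Numerator and denominator in lowest terms (up to a common scalar). *)
Definition rnum F : {poly K} :=
  let x := frac (repr F) in x.1 %/ gcdp x.1 x.2.
Definition rden F : {poly K} :=
  let x := frac (repr F) in x.2 %/ gcdp x.1 x.2.

(* Meant for [a] not a pole of [F]. *)
Definition reval F (a : K) : K := (rnum F).[a] / (rden F).[a].

Definition rderiv F : {fraction {poly K}} :=
  tofrac ((rnum F)^`() * rden F - rnum F * (rden F)^`())
  / tofrac (rden F ^+ 2).

(* Order of the pole of [F] at a point of the projective line, [None] being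
   the point at infinity; it is [0] when [F] has no pole there. *)
Definition pole_order F (p : option K) : nat :=
  if p is Some a then mup a (rden F) else (size (rnum F) - size (rden F))%N.

Definition is_pole F (p : option K) : Prop := (0 < pole_order F p)%N.

Definition y2D F : {fraction {poly K}} := tofrac ('X ^+ 2) * rderiv F.

(* A polynomial in [y] whose coefficients are polynomials in two variables,
   with these specialized to [A] and [B]. *)
Definition spec2 (P : {poly {poly {poly K}}}) (A B : K) : {poly K} :=
  map_poly (fun c : {poly {poly K}} => c.[A, B]) P.

End RationalFunctions.

(* Main.v *)
(* With [y = 1 + z y ^ B], the powers [y ^ x] have power series in [z] whose
   coefficients [a_k x] are polynomials in [x] satisfying
   [a_(k+1) (x + 1) - a_(k+1) x = a_k (x + B)].  This recurrence alone gives
   the Rothe-Hagen convolution, hence [y ^ (x + x') = y ^ x * y ^ x'], and the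
   inversion
   [f k * binomial (A + B k) k = sum_(r <= k) (-1)^r fhat r a_(k-r) (A + (B - 1) r)].
   Since [(1 - y) / y = - z y ^ (B - 1)], the latter says that the series in
   [z] is [y ^ A * sum_r fhat r ((1 - y) / y) ^ r].
   For [l = - m <= 0], [fhat r] is an [r]-th difference of a polynomial of lower
   degree once [r > m], so [F] is a polynomial of degree [m] in [(1 - y) / y].
   For [l = n + 1], reading [fhat r] off [(1 + x)^(A + n) (1 - (1 + x)^B)^r]
   shows that it is [(- B) ^ r] times a polynomial of degree [2 n] in [r], so
   [F] is a polynomial of degree [2 n + 1] in [v = y / (B + (1 - B) y)]; as
   [y^2 D v^k = k B v^(k+1)], it is also the [n]-th image of a polynomial of
   degree [n + 1] in [v]. *)
Require Import Defs.
From HB Require Import structures.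
From mathcomp Require Import all_boot all_order all_algebra.
From mathcomp Require Import all_classical all_reals all_analysis.
From mathcomp Require Import complex polyXY ring lra zify.
Set Implicit Arguments.
Unset Strict Implicit.
Unset Printing Implicit Defensive.
Import Order.TTheory GRing.Theory Num.Theory numFieldNormedType.Exports.
Local Open Scope classical_set_scope.
Local Open Scope ring_scope.

(** The analytic side uses no theory of holomorphic functions: geometric bounds on the [a_k x], of
    ratio 2^(b+1) when |B| <= b, make all series converge absolutely on an explicit disc. The
    delicate point is that y^x, obtained as a power series, must be the principal power
    [cexp (x * clog y)]; multiplicativity in x reduces this to the expansion 1 + h log y + O(h^2)
    for small h. For l = n + 1 the exact exponents of v matter. With t = (1 - y) / y one has v = 1 /
    (1 + B t), so the sum over r of binomial(r + p, p) (- B t)^r is v^(p+1). The factor (r + n)! /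
    r! in [fhat] confines p to n, ..., 2 n; hence F contains only v^(n+1), ..., v^(2n+1), and this
    is what allows it to be integrated n times under y^2 D. Its leading coefficient contains the
    n-th power of B (B - 1) / 2, so B != 1 keeps the pole order from dropping. Finally, numerator
    and denominator are chosen before A and B, so every division by an expression in A and B is
    cleared by a common denominator that is itself polynomial in them. *)

Lemma horner_nat_eq0 (K : numDomainType) (p : {poly K}) :
  (forall n, p.[n%:R] = 0) -> p = 0.
Proof.
move=> p0; apply: (@roots_geq_poly_eq0 _ p [seq i%:R | i <- iota 0 (size p)]).
- by apply/allP => _ /mapP[i _ ->]; apply/rootP.
- by rewrite map_inj_uniq ?iota_uniq // => i j /eqP; rewrite eqr_nat => /eqP.
- by rewrite size_map size_iota.
Qed.

(** * Polynomial functions, determined by their values at the natural numbers *)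

Section PolynomialFunctions.
Variable K : numDomainType.
Implicit Types f g : K -> K.

Definition polyfun f := exists p : {poly K}, forall x, f x = p.[x].

Lemma polyfun_cst c : polyfun (fun=> c).
Proof. by exists c%:P => x; rewrite hornerC. Qed.

Lemma polyfun_id : polyfun id.
Proof. by exists 'X => x; rewrite hornerX. Qed.

Lemma polyfunD f g : polyfun f -> polyfun g -> polyfun (fun x => f x + g x).
Proof. by move=> [p fp] [q gq]; exists (p + q) => x; rewrite hornerD fp gq. Qed.

Lemma polyfunM f g : polyfun f -> polyfun g -> polyfun (fun x => f x * g x).
Proof. by move=> [p fp] [q gq]; exists (p * q) => x; rewrite hornerM fp gq. Qed.

Lemma polyfun_sum n (F : 'I_n -> K -> K) : (forall i, polyfun (F i)) ->
  polyfun (fun x => \sum_(i < n) F i x).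
Proof.
move=> /boolp.choice[p Fp]; exists (\sum_(i < n) p i) => x.
by rewrite horner_sum; apply: eq_bigr => i _; rewrite Fp.
Qed.

Lemma polyfun_prod n (F : 'I_n -> K -> K) : (forall i, polyfun (F i)) ->
  polyfun (fun x => \prod_(i < n) F i x).
Proof.
move=> /boolp.choice[p Fp]; exists (\prod_(i < n) p i) => x.
by rewrite horner_prod; apply: eq_bigr => i _; rewrite Fp.
Qed.

Lemma polyfun_comp f g : polyfun f -> polyfun g -> polyfun (fun x => f (g x)).
Proof. by move=> [p fp] [q gq]; exists (p \Po q) => x; rewrite horner_comp fp gq. Qed.

Lemma polyfun_addr c : polyfun (+%R^~ c).
Proof. exact: polyfunD polyfun_id (polyfun_cst c). Qed.

Lemma polyfun_ext f g : polyfun f -> polyfun g ->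
  (forall n, f n%:R = g n%:R) -> f =1 g.
Proof.
move=> [p fp] [q gq] fg x; apply/eqP; rewrite fp gq -subr_eq0 -hornerN -hornerD.
rewrite [p - q]horner_nat_eq0 ?horner0// => n.
by rewrite hornerD hornerN -fp -gq fg subrr.
Qed.

End PolynomialFunctions.

(** * Coefficients of y^x: convolution, orthogonality and binomial inversion *)

Section BinomialIdentities.
Variable R : realType.
Local Notation C := (Cplx R).
Implicit Types (x y A B : C) (k n r : nat).

Lemma cbin0 x : cbin x 0 = 1.
Proof. by rewrite /cbin /rising big_ord0 fact0 divr1. Qed.

Lemma natr_neq0 n : n.+1%:R != 0 :> C.
Proof. by rewrite pnatr_eq0. Qed.
Local Hint Resolve natr_neq0 : core.

Lemma natrS_neq0 n : n%:R + 1 != 0 :> C.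
Proof. by rewrite natr1 pnatr_eq0. Qed.
Local Hint Resolve natrS_neq0 : core.

Lemma fact_neq0 n : n`!%:R != 0 :> C.
Proof. by rewrite pnatr_eq0 -lt0n fact_gt0. Qed.
Local Hint Resolve fact_neq0 : core.

Lemma risingSl x n : rising x n.+1 = x * rising (x + 1) n.
Proof.
rewrite /rising big_ord_recl addr0; congr (_ * _).
by apply: eq_bigr => i _; rewrite lift0 -natr1; ring.
Qed.

Lemma risingSr x n : rising x n.+1 = rising x n * (x + n%:R).
Proof. by rewrite /rising big_ord_recr. Qed.

Lemma cbinS x r : cbin x r.+1 = cbin x r * (x - r%:R) / r.+1%:R.
Proof.
rewrite /cbin.
have -> : x - r.+1%:R + 1 = x - r%:R by rewrite -natr1; ring.
by rewrite risingSl factS natrM -natr1; field; rewrite natrS_neq0 fact_neq0.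
Qed.

Lemma cbin1S x r : cbin (x + 1) r.+1 = (x + 1) / r.+1%:R * cbin x r.
Proof.
rewrite /cbin.
have -> : x + 1 - r.+1%:R + 1 = x - r%:R + 1 by rewrite -natr1; ring.
by rewrite risingSr factS natrM -natr1; field; rewrite natrS_neq0 fact_neq0.
Qed.

Lemma cbin_pascal x r : cbin (x + 1) r.+1 = cbin x r.+1 + cbin x r.
Proof. by rewrite cbin1S cbinS -natr1; field; rewrite natrS_neq0. Qed.

Lemma cbin0S r : cbin (0 : C) r.+1 = 0.
Proof. by elim: r => [|r IH]; rewrite cbinS ?IH ?subrr ?mulr0 ?mul0r. Qed.

Lemma cbin_nat n r : cbin n%:R r = 'C(n, r)%:R :> C.
Proof.
elim: n r => [|n IH] [|r]; rewrite ?cbin0 ?bin0 ?cbin0S//.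
by rewrite -natr1 cbin_pascal !IH binS natrD.
Qed.

Lemma polyfun_rising n : polyfun (fun x : C => rising x n).
Proof. by apply: polyfun_prod => i; apply: polyfun_addr. Qed.

Lemma polyfun_cbin r : polyfun (fun x : C => cbin x r).
Proof.
apply: polyfunM (polyfun_cst _).
apply: (polyfun_comp (polyfun_rising r)).
exact: polyfunD (polyfun_addr _) (polyfun_cst _).
Qed.

(* The coefficient of [z ^ k] in [y ^ x], where [y = 1 + z y ^ B]; the
   usual [x / (x + B k) * binomial (x + B k) k] has been simplified so as not
   to divide by zero. *)
Definition raney B k x : C :=
  if k is k'.+1 then x / k%:R * cbin (x + B * k%:R - 1) k' else 1.

Lemma raney0 B k : raney B k 0 = (k == 0)%:R.
Proof. by case: k => //= k; rewrite !mul0r. Qed.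

(** The equation y = 1 + z y^B multiplied by y^x, that is y^(x+1) = y^x + z y^(x+B), read at
    z^(k+1). *)
Lemma raneyS B k x : raney B k.+1 (x + 1) = raney B k.+1 x + raney B k (x + B).
Proof.
case: k => [|k] /=; first by rewrite !cbin0 !divr1 !mulr1.
have -> : x + 1 + B * k.+2%:R - 1 = (x + B * k.+2%:R - 1) + 1 by ring.
have -> : x + B + B * k.+1%:R - 1 = x + B * k.+2%:R - 1.
  by rewrite -[k.+2%:R]natr1; ring.
rewrite cbin1S cbinS -[k.+2%:R]natr1 -[k.+1%:R]natr1.
field; rewrite natrS_neq0 /=.
by rewrite -addrA -[1 + 1]/(2%:R) -natrD addn2.
Qed.

Lemma polyfun_raney B k : polyfun (raney B k).
Proof.
case: k => [|k]; first exact: polyfun_cst.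
apply: polyfunM; first exact: polyfunM (@polyfun_id _) (polyfun_cst _).
apply: (polyfun_comp (polyfun_cbin k)).
exact: polyfunD (polyfun_addr _) (polyfun_cst _).
Qed.

(* Both sides are polynomials in [y] that agree at [0] and, by induction on
   [k], have the same differences. *)
Lemma raney_convolution B (g : nat -> C -> C) :
  (forall k, polyfun (g k)) ->
  (forall k x, g k.+1 (x + 1) = g k.+1 x + g k (x + B)) ->
  (forall x y, g 0 x = g 0 y) ->
  forall k x y, \sum_(j < k.+1) g j x * raney B (k - j) y = g k (x + y).
Proof.
move=> gP gS g0; elim=> [|k IH] x y.
  by rewrite big_ord1 mulr1; apply: g0.
move: y; apply: polyfun_ext => [| |n].
- apply: polyfun_sum => j; apply: polyfunM (polyfun_cst _) (polyfun_raney _ _).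
- by apply: (polyfun_comp (gP _)); apply: polyfunD (polyfun_cst _) (@polyfun_id _).
elim: n => [|n IHn].
  rewrite big_ord_recr/= subnn mulr1 addr0 big1 ?add0r// => j _.
  by rewrite mulr0n raney0 subn_eq0 leqNgt ltn_ord mulr0.
(* When the second argument grows from [n] to [n + 1], [raneyS] splits each term; the additional
   parts form the convolution of index [k] at [n%:R + B], to which the induction hypothesis on [k]
   applies. *)
rewrite -natr1 addrA gS -IHn -addrA -IH [in RHS]big_ord_recr [in LHS]big_ord_recr.
rewrite /= subnn /= addrAC; congr (_ + _); rewrite -big_split /=.
apply: eq_bigr => j _; have /subnSK <- : (j < k.+1)%N := ltn_ord j.
by rewrite subSS raneyS mulrDr.
Qed.

Lemma raneyD B k x y :
  \sum_(j < k.+1) raney B j x * raney B (k - j) y = raney B k (x + y).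
Proof.
apply: (raney_convolution (g := raney B)) => //; first exact: polyfun_raney.
exact: raneyS.
Qed.

(** For B = 0 the equation is y = 1 + z, so y^x is the binomial series and the convolution above
    becomes Vandermonde's identity. *)
Lemma raney_B0 k x : raney 0 k x = cbin x k.
Proof.
case: k => [|k]; rewrite ?cbin0//= mul0r addr0.
by rewrite -[in RHS](subrK 1 x) cbin1S subrK.
Qed.

Lemma cbinD k x y : \sum_(j < k.+1) cbin x j * cbin y (k - j) = cbin (x + y) k.
Proof. by rewrite -raney_B0 -raneyD; apply: eq_bigr => j _; rewrite !raney_B0. Qed.

(* The coefficient of [z ^ n] in [y ^ x (1 - z y ^ (B - 1)) ^ x = 1]; the
   proof shows that the sum is a polynomial in [x] of period [1]. *)
Lemma raney_orthogonality B n x :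
  \sum_(s < n.+1) (-1) ^+ s * cbin x s * raney B (n - s) (x + (B - 1) * s%:R) =
    (n == 0)%:R.
Proof.
move: x; apply: polyfun_ext; last first.
- elim=> [|m IH].
    rewrite big_ord_recl /= big1 => [|i _]; last first.
      by rewrite /bump leq0n add1n cbin0S mulr0 mul0r.
    by rewrite addr0 expr0 cbin0 !mul1r subn0 mulr0 add0r raney0.
  rewrite -IH -natr1; set x := m%:R; case: n {IH} => [|n].
    by rewrite !big_ord1 !cbin0.
  pose t s := (-1) ^+ s * cbin x s * raney B (n - s) (x + 1 + (B - 1) * s.+1%:R).
  (* Pascal's rule on [cbin (x + 1) s] splits the sum. Its second half, reindexed by one, is exactly
     what [raneyS] removes from the first half to turn the argument [x + 1] of [raney] into [x]. *)
  transitivity (\sum_(s < n.+2) (-1) ^+ s * cbin x s *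
       raney B (n.+1 - s) (x + 1 + (B - 1) * s%:R) - \sum_(s < n.+1) t s).
    rewrite [in LHS]big_ord_recl [in RHS]big_ord_recl !cbin0 -[RHS]addrA.
    congr (_ + _); rewrite -sumrB; apply: eq_bigr => s _.
    by rewrite lift0 cbin_pascal /t subSS exprS; ring.
  rewrite [in LHS]big_ord_recr [in RHS]big_ord_recr /= addrAC subnn.
  congr (_ + _); rewrite -sumrB; apply: eq_bigr => s _.
  have /subnSK <- : (s < n.+1)%N := ltn_ord s.
  rewrite subSS /t -mulrBr; congr (_ * _).
  rewrite [x + 1 + _]addrAC raneyS.
  have -> : x + 1 + (B - 1) * s.+1%:R = x + (B - 1) * s%:R + B.
    by rewrite -natr1; ring.
  by rewrite addrK.
- exact: polyfun_cst.
- apply: polyfun_sum => s; apply: polyfunM.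
    exact: polyfunM (polyfun_cst _) (polyfun_cbin _).
  exact: (polyfun_comp (polyfun_raney _ _)) (polyfun_addr _).
Qed.

Lemma cbin_mul_bin x j d :
  cbin x (j + d) * 'C(j + d, j)%:R = cbin x j * cbin (x - j%:R) d.
Proof.
elim: d => [|d IH]; first by rewrite addn0 binn cbin0.
have e : (j + d).+1%:R * 'C(j + d, j)%:R = d.+1%:R * 'C((j + d).+1, j)%:R :> C.
  have := mul_bin_down (j + d).+1 j.
  by rewrite /= subSn ?leq_addr// addKn -!natrM => ->.
rewrite addnS !cbinS.
have -> : cbin x j * (cbin (x - j%:R) d * (x - j%:R - d%:R) / d.+1%:R) =
    cbin x j * cbin (x - j%:R) d * (x - j%:R - d%:R) / d.+1%:R by ring.
rewrite -IH; apply: (mulIf (natr_neq0 d)); rewrite mulfVK// natrD.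
rewrite -[LHS]mulrA [_ * d.+1%:R]mulrC -e.
by move: (natr_neq0 (j + d)); move: (j + d).+1%:R => u u0; field.
Qed.

Definition bin_transform B A (f : nat -> C) r : C :=
  \sum_(j < r.+1) (-1) ^+ j * 'C(r, j)%:R * cbin (A + B * j%:R) r * f j.

(** After exchanging the sums, trinomial revision ([cbin_mul_bin]) extracts
    [f j * cbin (A + B j) j]. What remains is [raney_orthogonality] of index [k - j] at the point
    [A + (B - 1) j], so only [j = k] survives. Nothing about [f] enters. *)
Lemma bin_transformK B A (f : nat -> C) k :
  \sum_(r < k.+1) (-1) ^+ r * bin_transform B A f r
                   * raney B (k - r) (A + (B - 1) * r%:R) =
    f k * cbin (A + B * k%:R) k.
Proof.
pose t r j := (-1) ^+ r * ((-1) ^+ j * 'C(r, j)%:R * cbin (A + B * j%:R) r * f j)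
  * raney B (k - r) (A + (B - 1) * r%:R).
transitivity (\sum_(j < k.+1) \sum_(r < k.+1 | (j <= r)%N) t r j).
  rewrite (exchange_big_dep predT) //=; apply: eq_bigr => r _.
  rewrite mulr_sumr mulr_suml [RHS]big_mkcond /=.
  rewrite -(big_mkord predT (fun j => t r j)) -(big_mkord predT (fun j => if (j <= r)%N then t r j else 0)) /=.
  rewrite [RHS](big_cat_nat _ (n := r.+1)) //=.
  rewrite [X in _ = _ + X]big_nat_cond [X in _ = _ + X]big1 ?addr0.
    by apply: eq_big_nat => j /andP[_]; rewrite ltnS => ->.
  by move=> j; rewrite andbT => /andP[]; rewrite ltnNge => /negbTE ->.
have key (j : 'I_k.+1) : \sum_(r < k.+1 | (j <= r)%N) t r j =
    f j * cbin (A + B * j%:R) j * (k - j == 0)%N%:R.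
  have jk : (j <= k)%N by rewrite -ltnS.
  rewrite -(raney_orthogonality B (k - j) (A + (B - 1) * j%:R)) mulr_sumr.
  rewrite -(big_mkord (fun r => j <= r)%N (fun r => t r j)).
  rewrite (big_cat_nat _ (n := j)) ?(leqW jk)//= big_nat_cond big_pred0; last first.
    by move=> r; rewrite andbC; case: leqP.
  rewrite add0r -{1}[nat_of_ord j]add0n big_addn subSn// big_mkord.
  apply: eq_big => [s|s _]; first by rewrite /= leq_addl.
  rewrite /t.
  have -> : (k - (s + j) = k - j - s)%N by rewrite addnC subnDA.
  have -> : A + (B - 1) * (s + j)%:R = A + (B - 1) * j%:R + (B - 1) * s%:R.
    by rewrite natrD; ring.
  rewrite -[(-1) ^+ j * _ * _]mulrA [_%:R * cbin _ _]mulrC [(s + j)%N]addnC cbin_mul_bin.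
  have -> : A + B * j%:R - j%:R = A + (B - 1) * j%:R by ring.
  rewrite exprD; have : (-1) ^+ j * (-1) ^+ j = 1 :> C by rewrite -expr2 sqrr_sign.
  by move: ((-1) ^+ j) => u uu; rewrite -[LHS]mul1r -[RHS]mul1r -uu; ring: uu.
rewrite (eq_bigr _ (fun j _ => key j)) big_ord_recr /= subnn eqxx mulr1 big1 ?add0r// => j _.
by rewrite subn_eq0 leqNgt ltn_ord mulr0.
Qed.

Lemma fhatE l A B r : fhat l A B r = bin_transform B A (fl l A B) r.
Proof. by []. Qed.

End BinomialIdentities.

(** * Alternating binomial sums as iterated differences *)

Section FiniteDifferences.
Variable R : realType.
Local Notation C := (Cplx R).
Implicit Types (f g : nat -> C) (x A B : C).

Definition altsum r f : C := \sum_(k < r.+1) (-1) ^+ k * 'C(r, k)%:R * f k.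

Lemma altsumS r f : altsum r.+1 f = altsum r (fun k => f k - f k.+1).
Proof.
rewrite /altsum big_ord_recl bin0 expr0.
under eq_bigr => k _ do rewrite lift0 binS natrD mulrDr mulrDl.
rewrite big_split /= addrA.
under [X in _ = X]eq_bigr => k _ do rewrite mulrBr.
rewrite sumrB; congr (_ + _); last first.
  by rewrite -sumrN; apply: eq_bigr => k _; rewrite exprS mulN1r !mulNr.
rewrite [RHS]big_ord_recl bin0 expr0 big_ord_recr /= bin_small// mulr0 mul0r addr0.
by congr (_ + _); apply: eq_bigr => k _; rewrite /bump leq0n add1n.
Qed.

(* [f] is a polynomial function of degree less than [d]. *)
Fixpoint fdeg d f : Prop :=
  if d is d'.+1 then fdeg d' (fun k => f k - f k.+1) else forall k, f k = 0.

Lemma fdeg_altsum r f : fdeg r f -> altsum r f = 0.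
Proof.
elim: r f => [|r IH] f /= fd; last by rewrite altsumS IH.
by rewrite /altsum big_ord1 fd mulr0.
Qed.

Lemma eq_fdeg d f g : f =1 g -> fdeg d f -> fdeg d g.
Proof.
elim: d f g => [|d IH] f g fg /=; first by move=> f0 k; rewrite -fg.
by apply: IH => k; rewrite !fg.
Qed.

Lemma fdegD d f g : fdeg d f -> fdeg d g -> fdeg d (fun k => f k + g k).
Proof.
elim: d f g => [|d IH] f g /= fd gd; first by move=> k; rewrite fd gd addr0.
by apply: eq_fdeg (IH _ _ fd gd) => k; ring.
Qed.

Lemma fdegZ d c f : fdeg d f -> fdeg d (fun k => c * f k).
Proof.
elim: d f => [|d IH] f /= fd; first by move=> k; rewrite fd mulr0.
by apply: eq_fdeg (IH _ fd) => k; ring.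
Qed.

Lemma fdeg_shift d f : fdeg d f -> fdeg d (fun k => f k.+1).
Proof. by elim: d f => [|d IH] f /= fd; [move=> k; rewrite fd | exact: (IH (fun k => f k - f k.+1))]. Qed.

Lemma fdeg_leq d d' f : (d <= d')%N -> fdeg d f -> fdeg d' f.
Proof.
move=> /subnKC <-; elim: (d' - d)%N => [|e IH] fd; first by rewrite addn0.
have {fd} := IH fd; rewrite addnS; elim: (d + e)%N f {IH} => [|c IH] f fd.
  by move=> k; rewrite !fd subrr.
exact: (IH (fun k => f k - f k.+1)).
Qed.

(** Discrete product rule: the difference of the product is [(a + b k)] times the difference of [f],
    minus [b] times the shift of [f]. *)
Lemma fdegM d a b f : fdeg d f -> fdeg d.+1 (fun k => (a + b * k%:R) * f k).
Proof.
elim: d f => [|d IH] f fd; first by move=> k /=; rewrite !fd !mulr0 subrr.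
have := fdegD (IH _ fd) (fdegZ (- b) (fdeg_shift fd)); apply: eq_fdeg => k.
by rewrite -natr1; ring.
Qed.

Lemma fdeg_rising A B n : fdeg n.+1 (fun k => rising (A + B * k%:R) n).
Proof.
elim: n A => [|n IH] A.
  by move=> k; rewrite /rising !big_ord0 subrr.
apply: eq_fdeg (fdegM A B (IH (A + 1))) => k.
by rewrite risingSl addrAC.
Qed.

(** In the induction the two products share all factors except the first and the last, which differ
    by [B * m.+1]. The explicit value serves to show that the top coefficient for l = - m does not
    vanish. *)
Lemma altsum_inv m x B : (forall k, x + B * k%:R != 0) ->
  altsum m (fun k => (x + B * k%:R)^-1) =
    m`!%:R * B ^+ m / \prod_(k < m.+1) (x + B * k%:R).
Proof.
elim: m x => [|m IH] x x0.
  by rewrite /altsum !big_ord1 bin0 expr0 !mul1r.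
have e k : x + B * k.+1%:R = x + B + B * k%:R by rewrite -natr1; ring.
have x0' k : x + B + B * k%:R != 0 by rewrite -e.
rewrite altsumS; transitivity (altsum m (fun k => (x + B * k%:R)^-1)
    - altsum m (fun k => (x + B + B * k%:R)^-1)).
  by rewrite /altsum -sumrB; apply: eq_bigr => k _; rewrite -e mulrBr.
pose P := \prod_(i < m) (x + B + B * i%:R).
have P0 : P != 0 by apply/prodf_neq0.
have x00 := x0 0%N; rewrite mulr0 addr0 in x00; have xm := x0' m.
have recl n : \prod_(k < n.+1) (x + B * k%:R) = x * \prod_(k < n) (x + B + B * k%:R).
  rewrite big_ord_recl mulr0 addr0; congr (_ * _).
  by apply: eq_bigr => k _; rewrite lift0 e.
rewrite !IH// !recl big_ord_recr /= -/P factS natrM -natr1 exprS.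
by field; rewrite x00 xm P0.
Qed.

End FiniteDifferences.

(** * Closed forms of [fhat], for l <= 0 and for l > 0 *)

Section ClosedForms.
Variable R : realType.
Local Notation C := (Cplx R).
Implicit Types (x A B : C) (k n m r j i : nat).

Let factn0 n : n`!%:R != 0 :> C := @fact_neq0 R n.

Lemma rising_neq0 x n i : rising x n != 0 -> (i < n)%N -> x + i%:R != 0.
Proof. by move=> /prodf_neq0 x0 i_n; apply: (x0 (Ordinal i_n)). Qed.

Lemma risingD x m n : rising x (m + n) = rising x m * rising (x + m%:R) n.
Proof.
rewrite /rising big_split_ord /=; congr (_ * _).
by apply: eq_bigr => i _; rewrite natrD addrA.
Qed.

Section Nonpositive.
Variables (m : nat) (A B : C).
Hypothesis def : forall k, rising (A + B * k%:R - m%:R) m.+1 != 0.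

Lemma fl_npos k : fl (- m%:Z) A B k =
  rising (A - m%:R) m.+1 / rising (A + B * k%:R - m%:R) m.+1.
Proof.
have E x : poch (x + 1) (- m%:Z - 1) = (rising (x - m%:R) m.+1)^-1 :> C.
  have -> : - m%:Z - 1 = Negz m by rewrite NegzE -addn1 PoszD opprD.
  by rewrite /poch -natr1; congr (rising _ _)^-1; ring.
by rewrite /fl !E invrK mulrC.
Qed.

(** For r > m the denominator of [fl] divides the numerator of [cbin (A + B k) r]. The quotient is a
    polynomial in k of degree at most r - m - 1, which the r-th difference kills. *)
Lemma fhat_npos_gt r : (m < r)%N -> fhat (- m%:Z) A B r = 0.
Proof.
move=> mr; rewrite fhatE /bin_transform.
transitivity (rising (A - m%:R) m.+1 / r`!%:R *
    altsum r (fun k => rising (A - r%:R + 1 + B * k%:R) (r - m.+1))).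
  rewrite mulr_sumr; apply: eq_bigr => k _; rewrite fl_npos /cbin.
  have -> : rising (A + B * k%:R - r%:R + 1) r =
     rising (A - r%:R + 1 + B * k%:R) (r - m.+1) * rising (A + B * k%:R - m%:R) m.+1.
    transitivity (rising (A + B * k%:R - r%:R + 1) (r - m.+1 + m.+1)).
      by rewrite subnK.
    rewrite risingD; congr (rising _ _ * rising _ _); first by ring.
    by rewrite natrB// -natr1; ring.
  by have := def k; move: (rising (_ - m%:R) _) => u u0; field; rewrite u0 factn0.
rewrite fdeg_altsum ?mulr0//.
by apply: fdeg_leq (fdeg_rising (A - r%:R + 1) B (r - m.+1)); lia.
Qed.

(** Here the divisibility is reversed: the r factors of the binomial cancel the last r of the m + 1
    factors below. For r = m a single linear factor remains, which is the case of [altsum_inv]. *)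
Lemma fhat_npos_le r : (r <= m)%N -> fhat (- m%:Z) A B r =
  rising (A - m%:R) m.+1 / r`!%:R *
  altsum r (fun k => (rising (A + B * k%:R - m%:R) (m.+1 - r))^-1).
Proof.
move=> rm; rewrite fhatE /bin_transform mulr_sumr; apply: eq_bigr => k _.
rewrite fl_npos /cbin.
have e : rising (A + B * k%:R - m%:R) m.+1 =
    rising (A + B * k%:R - m%:R) (m.+1 - r) * rising (A + B * k%:R - r%:R + 1) r.
  rewrite -{1}(subnK (leqW rm)) risingD; congr (_ * rising _ _).
  by rewrite natrB ?leqW// -natr1; ring.
have := def k; rewrite e mulf_eq0 negb_or => /andP[].
move: (rising _ (_ - _)) (rising _ r) => u v u0 v0.
by field; rewrite u0 v0 factn0.
Qed.

Lemma fhat_npos_top : B != 0 -> fhat (- m%:Z) A B m != 0.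
Proof.
move=> B0; rewrite fhat_npos_le// subSnn.
have D k : A - m%:R + B * k%:R != 0.
  by have := rising_neq0 (def k) (ltn0Sn m); rewrite addr0 addrAC.
rewrite [altsum _ _](_ : _ = altsum m (fun k => (A - m%:R + B * k%:R)^-1)).
  rewrite altsum_inv//; do !apply: mulf_neq0; rewrite ?invr_eq0 ?expf_neq0//.
    by have := def 0%N; rewrite mulr0 addr0.
  exact/prodf_neq0.
by apply: eq_bigr => k _; rewrite /rising big_ord1 addr0 [A + _ - _]addrAC.
Qed.

End Nonpositive.

Section Positive.
Variables (n : nat) (A B : C).

Lemma fl_pos k :
  fl n.+1%:Z A B k = rising (A + B * k%:R + 1) n / rising (A + 1) n.
Proof. by rewrite /fl -[n.+1]addn1 PoszD addrK. Qed.

Definition diffbin r : C :=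
  altsum r (fun k => cbin (A + n%:R + B * k%:R) (r + n)).

(** The n factors of [rising (A + B k + 1) n] prolong the r factors of [cbin (A + B k) r] upwards,
    so together they form one binomial of [A + n + B k], up to factorials. *)
Lemma fhat_pos_diffbin r : fhat n.+1%:Z A B r =
  (r + n)`!%:R / r`!%:R * diffbin r / rising (A + 1) n.
Proof.
rewrite fhatE /bin_transform /diffbin /altsum mulr_sumr mulr_suml.
apply: eq_bigr => k _; rewrite fl_pos /cbin.
have -> : A + n%:R + B * k%:R - (r + n)%:R + 1 = A + B * k%:R - r%:R + 1.
  by rewrite natrD; ring.
rewrite risingD [_ + 1 + r%:R](_ : _ = A + B * k%:R + 1); last by ring.
have := factn0 (r + n).
move: (r + n)`!%:R (_ `!%:R) (factn0 r) (rising _ r) (rising _ n) (rising _ n)^-1 => f.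
by move=> g g0 u v w f0; field; rewrite f0 g0.
Qed.

(* The truncated series [(1 + x)^c] and [((1 + x)^B - 1) / x - B]. *)
Definition binpoly N (c : C) : {poly C} := \poly_(i < N) cbin c i.
Definition tailpoly N : {poly C} := 'X * \poly_(i < N) cbin B i.+2.

(** The coefficient of x^n in (1 + x)^(A+n) T^j, with T = ((1 + x)^B - 1) / x - B; the truncations
    lose nothing up to x^n. As T starts with [cbin B 2] times x, it vanishes for j > n and is
    [cbin B 2 ^+ n] for j = n. *)
Definition ccoef j : C := (binpoly n.+1 (A + n%:R) * tailpoly n ^+ j)`_n.

Lemma binpoly_mul N c k i : (i < N)%N ->
  (binpoly N c * binpoly N B ^+ k)`_i = cbin (c + B * k%:R) i.
Proof.
elim: k i => [|k IH] i iN.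
  by rewrite expr0 mulr1 mulr0 addr0 coef_poly iN.
rewrite exprSr mulrA coefM.
have -> : c + B * k.+1%:R = (c + B * k%:R) + B by rewrite -natr1; ring.
rewrite -cbinD; apply: eq_bigr => j _.
have jN : (j < N)%N by apply: leq_ltn_trans iN; rewrite -ltnS.
by rewrite IH// coef_poly (leq_ltn_trans (leq_subr _ _) iN).
Qed.

Lemma coef_mul_congr N (p p' q q' : {poly C}) :
  (forall i, (i <= N)%N -> p`_i = p'`_i) -> (forall i, (i <= N)%N -> q`_i = q'`_i) ->
  forall i, (i <= N)%N -> (p * q)`_i = (p' * q')`_i.
Proof.
move=> pp qq i iN; rewrite !coefM; apply: eq_bigr => j _.
by rewrite pp ?qq ?(leq_trans _ iN) ?leq_subr// -ltnS.
Qed.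

Lemma coef_exp_congr N (p p' : {poly C}) k :
  (forall i, (i <= N)%N -> p`_i = p'`_i) ->
  forall i, (i <= N)%N -> (p ^+ k)`_i = (p' ^+ k)`_i.
Proof.
move=> pp; elim: k => [|k IH] i iN; first by rewrite !expr0.
by rewrite !exprS; apply: (coef_mul_congr (N := N)).
Qed.

Lemma ccoefE M N j : (n < M)%N -> (n <= N)%N ->
  (binpoly M (A + n%:R) * tailpoly N ^+ j)`_n = ccoef j.
Proof.
move=> nM nN; apply: (coef_mul_congr (N := n)) => // i i_n.
  by rewrite !coef_poly (leq_ltn_trans i_n nM) ltnS i_n.
apply: (coef_exp_congr (N := n)) => // {i i_n} i i_n.
rewrite !coefXM; case: i i_n => //= i i_n.
by rewrite !coef_poly i_n (leq_trans i_n nN).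
Qed.

Lemma ccoef_gt j : (n < j)%N -> ccoef j = 0.
Proof.
by move=> nj; rewrite /ccoef /tailpoly exprMn mulrCA coefXnM nj.
Qed.

Lemma ccoef_top : ccoef n = cbin B 2 ^+ n.
Proof.
rewrite /ccoef /tailpoly exprMn mulrCA coefXnM ltnn subnn coef0M.
rewrite coef_poly ltn0Sn cbin0 mul1r -horner_coef0 horner_exp horner_coef0.
by case: n => [|k]; rewrite ?expr0// coef_poly.
Qed.

Lemma sum_ord_trim a b (t : nat -> C) : (a <= b)%N ->
  (forall j, (a <= j)%N -> t j = 0) -> \sum_(j < b) t j = \sum_(j < a) t j.
Proof.
move=> ab t0; rewrite -!(big_mkord predT t) (big_cat_nat _ (n := a))//=.
rewrite [X in _ + X]big_nat_cond [X in _ + X]big1 ?addr0// => j.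
by rewrite andbT => /andP[aj _]; apply: t0.
Qed.

(* [diffbin r] is the coefficient of [x ^ (r + n)] in
   [(1 + x)^(A + n) (1 - (1 + x)^B)^r]. *)
Lemma diffbin_ccoef r : B != 0 ->
  diffbin r = (- B) ^+ r * \sum_(j < n.+1) 'C(r, j)%:R * B^-1 ^+ j * ccoef j.
Proof.
move=> B0; set N := (r + n)%N.
have -> : diffbin r = (binpoly N.+2 (A + n%:R) * (1 - binpoly N.+2 B) ^+ r)`_N.
  rewrite [(1 - _) ^+ _]exprDn mulr_sumr coef_sum; apply: eq_bigr => k _.
  rewrite expr1n mul1r [RHS](_ : _ = ((-1) ^+ k * 'C(r, k)%:R) *
    (binpoly N.+2 (A + n%:R) * binpoly N.+2 B ^+ k)`_N); first by rewrite binpoly_mul.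
  rewrite -coefZ; congr (_`_N).
  congr (polyseq _); rewrite -mul_polyC polyCM polyC_exp polyCN polyC_natr exprNn -mulr_natr.
  by move: (binpoly _ _) (binpoly _ _) => p q; ring.
(* An exact equality of polynomials: with the truncation at [N.+2], both sides stop at degree N +
   1. *)
have -> : 1 - binpoly N.+2 B = - ('X * (B%:P + tailpoly N)).
  apply/polyP => i; rewrite coefB coefN coefXM coefD coef1 coefC coefXM !coef_poly.
  case: i => [|[|i]] /=; rewrite ?cbin0 ?subrr ?oppr0//.
    have -> : cbin B 1 = B by rewrite cbinS cbin0 mul1r subr0 divr1.
    by rewrite addr0 sub0r.
  by rewrite sub0r add0r !ltnS.
rewrite exprNn exprMn -[in LHS]signr_odd mulrCA.
rewrite (_ : (-1) ^+ odd r = ((-1) ^+ odd r)%:P); last by rewrite polyC_exp polyCN.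
rewrite coefCM signr_odd mulrCA coefXnM ltnNge leq_addr/= /N addKn -/N.
rewrite [in RHS]exprNn -mulrA; congr (_ * _).
rewrite exprDn mulr_sumr coef_sum.
pose t j := 'C(r, j)%:R * B ^+ (r - j) * ccoef j.
transitivity (\sum_(j < r.+1) t j).
  apply: eq_bigr => j _; rewrite -polyC_exp mulrnAr coefMn mulrCA coefCM.
  rewrite ccoefE ?leq_addl// ?ltnS ?(leq_trans (leq_addl r n))//.
  by rewrite /t -[LHS]mulr_natl mulrA.
(* The range r is exchanged for n through a common larger range: [t j] vanishes for j > r by its
   binomial and for j > n by [ccoef_gt]. *)
transitivity (\sum_(j < (r + n).+1) t j).
  rewrite (sum_ord_trim (a := r.+1) (b := (r + n).+1)) ?ltnS ?leq_addr// => j rj.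
  by rewrite /t bin_small ?mul0r.
rewrite (sum_ord_trim (a := n.+1)) ?ltnS ?leq_addl//; last first.
  by move=> j nj; rewrite /t ccoef_gt ?mulr0.
rewrite mulr_sumr; apply: eq_bigr => j _; rewrite /t.
case: (leqP j r) => [jr|rj]; last by rewrite bin_small ?mul0r ?mulr0.
rewrite -{3}(subnK jr) exprD exprVn.
by field; rewrite expf_neq0.
Qed.

Lemma cbin_upper_neg (c : C) i : cbin (- c) i = (-1) ^+ i * cbin (c + i%:R - 1) i.
Proof.
elim: i => [|i IH]; first by rewrite !cbin0 mulr1.
rewrite cbinS IH; have -> : c + i.+1%:R - 1 = c + i%:R - 1 + 1 by rewrite -natr1; ring.
by rewrite cbin1S exprS; ring.
Qed.

(** Upper negation turns the left side into a binomial of j - r - 1 = -(r + n + 1) + (n + j), which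
    Vandermonde expands. In this basis the factor (r + n)! / r! is absorbed: its product with
    binomial(r + n + i, i) is a multiple of binomial(r + n + i, r). *)
Lemma bin_shift_basis r j : (j <= n)%N -> 'C(r, j)%:R =
  \sum_(i < j.+1) (-1) ^+ (j - i) * 'C(n + j, j - i)%:R * 'C(r + n + i, i)%:R :> C.
Proof.
move=> jn.
have h : 'C(r, j)%:R = (-1) ^+ j * cbin (j%:R - r%:R - 1) j :> C.
  have -> : j%:R - r%:R - 1 = - (r%:R - j%:R + 1) :> C by ring.
  rewrite cbin_upper_neg mulrA -expr2 sqrr_sign mul1r -cbin_nat; congr (cbin _ _).
  by ring.
have e : j%:R - r%:R - 1 = - (r%:R + n%:R + 1) + (n + j)%:R :> C.
  by rewrite natrD; ring.
rewrite h e -cbinD mulr_sumr; apply: eq_bigr => i _.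
have ij : (i <= j)%N by rewrite -ltnS.
rewrite cbin_upper_neg !cbin_nat (_ : _ + 1 + i%:R - 1 = (r + n + i)%:R); last first.
  by rewrite !natrD; ring.
rewrite cbin_nat -{1}(subnK ij) exprD.
have : (-1) ^+ i * (-1) ^+ i = 1 :> C by rewrite -expr2 sqrr_sign.
by move: ((-1) ^+ i) => u uu; rewrite [RHS]mulrAC -[RHS]mul1r -uu; ring.
Qed.

Definition gcoef i : C :=
  \sum_(j < n.+1 | (i <= j)%N) (-1) ^+ (j - i) * 'C(n + j, j - i)%:R * B^-1 ^+ j * ccoef j.

(** These become the coefficients of v^(n+1+i) in F. *)
Definition hcoef i : C := gcoef i * (i + n)`!%:R / i`!%:R / rising (A + 1) n.

Lemma fhat_pos r : B != 0 -> fhat n.+1%:Z A B r =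
  (- B) ^+ r * \sum_(i < n.+1) hcoef i * 'C(r + (n + i), r)%:R.
Proof.
move=> B0; rewrite fhat_pos_diffbin diffbin_ccoef//.
have -> : \sum_(j < n.+1) 'C(r, j)%:R * B^-1 ^+ j * ccoef j =
    \sum_(i < n.+1) gcoef i * 'C(r + n + i, i)%:R.
  under [RHS]eq_bigr => i _ do rewrite mulr_suml.
  rewrite [RHS](exchange_big_dep predT) //=; apply: eq_bigr => j _.
  have jn : (j <= n)%N by rewrite -ltnS.
  rewrite (bin_shift_basis r jn) !mulr_suml.
  rewrite (big_ord_widen_cond n.+1 predT
    (fun i => (-1) ^+ (j - i) * 'C(n + j, j - i)%:R * 'C(r + n + i, i)%:R
              * B^-1 ^+ j * ccoef j)) ?ltn_ord//=.
  by apply: eq_big => i; rewrite ?ltnS// => _; ring.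
rewrite [_ * (_ ^+ r * _)]mulrCA -mulrA; congr (_ * _); rewrite mulr_sumr mulr_suml.
apply: eq_bigr => i _; rewrite /hcoef.
have F m k : 'C(m + k, k)%:R = (m + k)`!%:R / (m`!%:R * k`!%:R) :> C.
  apply: (mulIf (mulf_neq0 (factn0 m) (factn0 k))); rewrite mulfVK ?mulf_neq0//.
  by rewrite -!natrM [(m`! * _)%N]mulnC -{2}(addnK k m) bin_fact// leq_addl.
rewrite F [(r + (n + i))%N]addnC F [(n + i)%N]addnC.
have -> : (i + n + r = r + n + i)%N by lia.
have := factn0 (r + n); have := factn0 r; have := factn0 i.
have := factn0 (i + n); have := factn0 (r + n + i).
move: (_`!%:R) (_`!%:R) (_`!%:R) (_`!%:R) (_`!%:R) => f1 f2 f3 f4 f5 h1 h2 h3 h4 h5.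
by move: (rising _ n)^-1 (gcoef i) => u v; field; rewrite ?h1 ?h2 ?h3 ?h4 ?h5.
Qed.

(** Only j = n contributes to [gcoef n], with [ccoef n] equal to the n-th power of B (B - 1) / 2;
    this is where B != 1 is needed. *)
Lemma hcoef_top : B != 0 -> B != 1 -> rising (A + 1) n != 0 -> hcoef n != 0.
Proof.
move=> B0 B1 A0; rewrite /hcoef /gcoef.
rewrite (big_pred1 ord_max) => [|j]; last first.
  apply/idP/eqP => [nj|->//]; apply/val_inj/eqP.
  by rewrite eqn_leq nj andbT -ltnS ltn_ord.
rewrite subnn bin0 expr0 !mul1r ccoef_top.
do !apply: mulf_neq0 => //; rewrite ?expf_neq0 ?invr_eq0//.
rewrite !cbinS cbin0 subr0 mul1r divr1; do !apply: mulf_neq0 => //.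
by rewrite subr_eq0.
Qed.

End Positive.

End ClosedForms.

(** * Derivative, value and poles of a fraction, from any representation *)

Section RationalFunctionTheory.
Variable K : fieldType.
Implicit Types (F G : {fraction {poly K}}) (p q H : {poly K}).
Local Notation tofrac := (@FracField.tofrac {poly K}).

Lemma fraction_numden F : F = tofrac (frac (repr F)).1 / tofrac (frac (repr F)).2.
Proof.
set x := repr F; have x2 : (frac x).2 != 0 := denom_ratioP x.
have -> : F = (\pi_{fraction {poly K}} x)%qT by rewrite reprK.
apply: (canRL (mulfK _)); first by rewrite tofrac_eq0.
apply/eqP; unlock FracField.tofrac; rewrite -[_ * _]FracField.pi_mul piE.
by rewrite /FracField.mulf FracField.equivfE !numden_Ratio ?oner_eq0// ?mulr1// mulrC.
Qed.

Lemma rden_neq0 F : rden F != 0.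
Proof.
have d0 : (frac (repr F)).2 != 0 := denom_ratioP _.
by rewrite /rden dvdp_div_eq0 ?dvdp_gcdr.
Qed.

Lemma coprime_rnum_rden F : coprimep (rnum F) (rden F).
Proof. by apply: coprimep_div_gcd; rewrite (denom_ratioP (repr F)) orbT. Qed.

Lemma rnum_rden F : F = tofrac (rnum F) / tofrac (rden F).
Proof.
rewrite [LHS]fraction_numden /rnum /rden; set n := (frac _).1; set d := (frac _).2.
have d0 : d != 0 := denom_ratioP _.
have g0 : gcdp n d != 0 by rewrite gcdp_eq0 negb_and d0 orbT.
set g := gcdp n d in g0 *.
transitivity (tofrac (n %/ g * g) / tofrac (d %/ g * g)).
  by rewrite !divpK ?dvdp_gcdl ?dvdp_gcdr.
by rewrite !tofracM -mulf_div divff ?mulr1// tofrac_eq0.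
Qed.

Lemma tofrac_div_eq p q p' q' : q != 0 -> q' != 0 ->
  tofrac p / tofrac q = tofrac p' / tofrac q' -> p * q' = p' * q.
Proof.
move=> q0 q'0 /eqP; rewrite eqr_div ?tofrac_eq0// -!tofracM tofrac_eq.
by move/eqP.
Qed.

(** [rderiv] is defined on the reduced form n / d. Differentiating n q = p d relates the two
    numerators, so the quotient rule holds for unreduced representations too. *)
Lemma rderiv_div p q : q != 0 ->
  rderiv (tofrac p / tofrac q) = tofrac (p^`() * q - p * q^`()) / tofrac (q ^+ 2).
Proof.
move=> q0; set F := _ / _; rewrite /rderiv; have d0 := rden_neq0 F.
have := tofrac_div_eq q0 d0 (rnum_rden F).
move: (rnum F) (rden F) d0 => n d d0 e.
apply/eqP; rewrite eqr_div ?tofrac_eq0 ?expf_neq0// -!tofracM tofrac_eq; apply/eqP.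
have := congr1 (@deriv _) e; rewrite !derivM => e'.
have -> : (n^`() * d - n * d^`()) * q ^+ 2 =
  (n^`() * q + n * q^`()) * (d * q) - (n * q) * (q^`() * d + d^`() * q) by ring.
by rewrite -e -e'; ring.
Qed.

Lemma rderivD F G : rderiv (F + G) = rderiv F + rderiv G.
Proof.
rewrite (rnum_rden F) (rnum_rden G); have f0 := rden_neq0 F; have g0 := rden_neq0 G.
move: (rnum F) (rden F) (rnum G) (rden G) f0 g0 => p q p' q' q0 q'0.
rewrite addf_div ?tofrac_eq0// -!tofracM -tofracD !rderiv_div ?mulf_neq0//.
rewrite addf_div ?tofrac_eq0 ?expf_neq0// -!tofracM -tofracD.
apply/eqP; rewrite eqr_div ?tofrac_eq0 ?expf_neq0 ?mulf_neq0 ?expf_neq0//.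
rewrite -!tofracM tofrac_eq; apply/eqP; rewrite !derivD !derivM; ring.
Qed.

Lemma rderivM F G : rderiv (F * G) = rderiv F * G + F * rderiv G.
Proof.
rewrite (rnum_rden F) (rnum_rden G); have f0 := rden_neq0 F; have g0 := rden_neq0 G.
move: (rnum F) (rden F) (rnum G) (rden G) f0 g0 => p q p' q' q0 q'0.
rewrite mulf_div -!tofracM !rderiv_div ?mulf_neq0// !mulf_div -!tofracM.
rewrite addf_div ?tofrac_eq0 ?mulf_neq0 ?expf_neq0// -!tofracM -tofracD.
apply/eqP; rewrite eqr_div ?tofrac_eq0 ?expf_neq0 ?mulf_neq0 ?mulf_neq0 ?expf_neq0//.
rewrite -!tofracM tofrac_eq; apply/eqP; rewrite !derivM; ring.
Qed.

Lemma rderivC c : rderiv (tofrac c%:P) = 0.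
Proof.
rewrite -[tofrac c%:P]divr1 -[1]/(tofrac 1) rderiv_div ?oner_eq0//.
by rewrite derivC -[1]/(1%:P) derivC mul0r mulr0 subrr tofrac0 mul0r.
Qed.

Definition rcst : K -> {fraction {poly K}} := tofrac \o polyC.

Definition rcomp H F : {fraction {poly K}} := (map_poly rcst H).[F].

Lemma rcompM H1 H2 F : rcomp (H1 * H2) F = rcomp H1 F * rcomp H2 F.
Proof. by rewrite /rcomp rmorphM hornerM. Qed.

Lemma rcompC c F : rcomp c%:P F = rcst c.
Proof. by rewrite /rcomp map_polyC hornerC. Qed.

Lemma rcompXn n F : rcomp 'X^n F = F ^+ n.
Proof. by rewrite /rcomp map_polyXn hornerXn. Qed.

Lemma rderiv_comp H F : rderiv (rcomp H F) = rcomp H^`() F * rderiv F.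
Proof.
rewrite /rcomp; elim/poly_ind: H => [|H c IH].
  by rewrite deriv0 rmorph0 horner0 mul0r -tofrac0 -[0]/(0%:P) rderivC.
have -> : map_poly rcst (H * 'X + c%:P) = map_poly rcst H * 'X + (rcst c)%:P.
  by rewrite rmorphD rmorphM /= map_polyX map_polyC.
have -> : map_poly rcst (H * 'X + c%:P)^`() = map_poly rcst H + map_poly rcst H^`() * 'X.
  by rewrite derivMXaddC rmorphD rmorphM /= map_polyX.
rewrite !(hornerD, hornerM, hornerX, hornerC) rderivD rderivM IH rderivC.
by move: (rderiv F) => dF; ring.
Qed.

(** Two coprime representations have denominators dividing each other, hence equal multiplicities at
    a finite point; at infinity the sizes are compared through p d = n q. *)
Lemma pole_order_div p q a : q != 0 -> coprimep p q ->
  pole_order (tofrac p / tofrac q) a =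
    if a is Some x then mup x q else (size p - size q)%N.
Proof.
move=> q0 pq; set F := _ / _; have d0 := rden_neq0 F.
have := tofrac_div_eq q0 d0 (rnum_rden F); have := coprime_rnum_rden F.
rewrite /pole_order; move: (rnum F) (rden F) d0 => n d d0 nd e.
have qd : q %| d by rewrite -(@Gauss_dvdpr _ d p q) 1?coprimep_sym// e dvdp_mull.
have dq : d %| q by rewrite -(@Gauss_dvdpr _ q n d) 1?coprimep_sym// -e dvdp_mull.
have sdq : size d = size q by apply/eqp_size; rewrite /eqp dq qd.
case: a => [x|]; last first.
  have [n0|n0] := eqVneq n 0.
    have : p == 0 by rewrite -(mulIr_eq0 _ (mulIf d0)) e n0 mul0r.
    by rewrite n0 sdq => /eqP->.
  have p0 : p != 0.
    apply/eqP => p0; move: e; rewrite p0 mul0r => /esym/eqP.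
    by rewrite mulf_eq0 (negbTE n0) (negbTE q0).
  have := congr1 (fun r : {poly K} => size r) e; rewrite !size_mul// sdq.
  by move: (size_poly_gt0 q); rewrite q0; move: (size p) (size n) (size q); lia.
apply/eqP; rewrite eqn_leq !mup_geq//; apply/andP.
by split; [apply: dvdp_trans dq | apply: dvdp_trans qd]; rewrite -mup_geq.
Qed.

Lemma reval_div p q y : q != 0 -> q.[y] != 0 ->
  reval (tofrac p / tofrac q) y = p.[y] / q.[y].
Proof.
move=> q0 qy; set F := _ / _; have d0 := rden_neq0 F.
have := tofrac_div_eq q0 d0 (rnum_rden F); have := coprime_rnum_rden F.
rewrite /reval; move: (rnum F) (rden F) d0 => n d d0 nd e.
have dq : d %| q by rewrite -(@Gauss_dvdpr _ q n d) 1?coprimep_sym// -e dvdp_mull.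
have dy : d.[y] != 0.
  by case/dvdpP: dq qy => r ->; rewrite hornerM mulf_eq0 negb_or => /andP[].
by apply/eqP; rewrite eqr_div// -!hornerM e.
Qed.

(* [b ^ N * H (a / b)] *)
Definition homogenize N H (a b : {poly K}) : {poly K} :=
  \sum_(i < N.+1) H`_i *: (a ^+ i * b ^+ (N - i)).

Lemma rcomp_homogenize N H a b : (size H <= N.+1)%N -> b != 0 ->
  rcomp H (tofrac a / tofrac b) = tofrac (homogenize N H a b) / tofrac (b ^+ N).
Proof.
move=> sH b0; rewrite /rcomp (horner_coef_wide _ (n := N.+1)); last first.
  exact: leq_trans (size_poly _ _) sH.
rewrite /homogenize raddf_sum /= mulr_suml; apply: eq_bigr => i _.
rewrite coef_map /= /rcst /= -mul_polyC tofracM -mulrA; congr (_ * _).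
have -> : b ^+ N = b ^+ (N - i) * b ^+ i by rewrite -exprD subnK// -ltnS.
rewrite !tofracM !tofracXn expr_div_n.
have := expf_neq0 (N - i) (etrans (congr1 negb (tofrac_eq0 b)) b0).
by move=> u0; rewrite [X in _ = X / _]mulrC -mulf_div divff// mul1r.
Qed.

(** * Polynomials in a Mobius function of y *)

Section Mobius.
Variables (N : nat) (H a : {poly K}) (c x0 : K).
Hypotheses (sH : size H = N.+1) (sa : (size a <= 2)%N).
Hypotheses (c0 : c != 0) (a0 : a.[x0] != 0).
Let b := c *: ('X - x0%:P).
Let F := rcomp H (tofrac a / tofrac b).

Let b0 : b != 0.
Proof. by rewrite scaler_eq0 negb_or c0 polyXsubC_eq0. Qed.

Let bN0 : b ^+ N != 0.
Proof. exact: expf_neq0. Qed.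

Let bE y : b.[y] = c * (y - x0).
Proof. by rewrite hornerZ hornerXsubC. Qed.

Let FE : F = tofrac (homogenize N H a b) / tofrac (b ^+ N).
Proof. by rewrite /F (rcomp_homogenize (N := N)) ?sH. Qed.

(** At [x0] every term of the homogenized numerator except [i = N] contains a factor [b]; what is
    left is the leading coefficient of [H] times [a.[x0] ^+ N]. *)
Let cop : coprimep (homogenize N H a b) (b ^+ N).
Proof.
apply: coprimep_expr; rewrite coprimepZr// coprimep_XsubC rootE.
rewrite horner_sum big_ord_recr /= big1 => [|i _]; last first.
  rewrite hornerZ hornerM !horner_exp bE subrr mulr0 expr0n subn_eq0 leqNgt.
  by rewrite ltn_ord !mulr0.
rewrite add0r subnn expr0 mulr1 hornerZ horner_exp mulf_neq0 ?expf_neq0//.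
by have := lead_coef_eq0 H; rewrite /lead_coef sH /= => ->; rewrite -size_poly_eq0 sH.
Qed.

Lemma pole_order_mobius : pole_order F (Some x0) = N.
Proof.
by rewrite FE pole_order_div// exprZn -mul_polyC mupMr ?rootC ?expf_neq0// mup_XsubCX eqxx.
Qed.

(** A finite pole must be a root of [b ^+ N]. Infinity is excluded because [a] and [b] have degree
    at most 1, so the numerator has degree at most N, that of [b ^+ N]. *)
Lemma is_pole_mobius (p : option K) : is_pole F p -> p = Some x0.
Proof.
rewrite /is_pole FE pole_order_div//; case: p => [x|].
  have [->//|xx0] := eqVneq x x0.
  rewrite exprZn -mul_polyC mupMr ?rootC ?expf_neq0//.
  by rewrite mup_XsubCX eq_sym (negbTE xx0).
rewrite subn_gt0 ltnNge exprZn size_scale ?expf_neq0// size_exp_XsubC.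
case/negP; apply: leq_trans (size_sum _ _ _) _; apply/bigmax_leqP => i _.
apply: leq_trans (size_scale_leq _ _) _; apply: leq_trans (size_polyMleq _ _) _.
have := size_poly_exp_leq a i; have := size_poly_exp_leq b (N - i).
rewrite size_scale// size_XsubC; have := ltn_ord i.
move: (size (a ^+ i)) (size (b ^+ (N - i))) => s1 s2 iN; rewrite mul1n => h1 h2.
have : ((size a).-1 * i <= i)%N by move: (size a) sa => [|[|[|]]] //= _; lia.
by move: h2; move: ((size a).-1 * i)%N => k h2 ki; lia.
Qed.

Lemma reval_mobius y : y != x0 -> reval F y = H.[a.[y] / b.[y]].
Proof.
move=> yx0; have by0 : b.[y] != 0 by rewrite bE mulf_neq0 ?subr_eq0.
rewrite FE reval_div ?horner_exp ?expf_neq0//.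
rewrite [in RHS](horner_coef_wide _ (n := N.+1)) ?sH// /homogenize horner_sum mulr_suml.
apply: eq_bigr => i _; rewrite hornerZ hornerM !horner_exp -mulrA; congr (_ * _).
have -> : b.[y] ^+ N = b.[y] ^+ (N - i) * b.[y] ^+ i by rewrite -exprD subnK// -ltnS.
by rewrite expr_div_n -mulrA invfM mulVKf ?expf_neq0.
Qed.

End Mobius.

(** The hypothesis, satisfied by w = B + (1 - B) y, gives y^2 v' = B v^2. Thus y^2 D_y acts on
    functions of v as B v^2 D_v. *)
Lemma y2D_comp (B : K) H (w : {poly K}) : w != 0 -> w - 'X * w^`() = B%:P ->
  let v := tofrac 'X / tofrac w in
  y2D (rcomp H v) = rcomp (B *: ('X^2 * H^`())) v.
Proof.
move=> w0 we v; rewrite /y2D rderiv_comp.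
have e : tofrac ('X ^+ 2) * rderiv v = rcst B * v ^+ 2.
  rewrite rderiv_div// derivX mul1r we /v expr_div_n !tofracXn /rcst /=.
  by rewrite mulrCA.
have -> : rcomp (B *: ('X^2 * H^`())) v = rcst B * v ^+ 2 * rcomp H^`() v.
  by rewrite -mul_polyC rcompM rcompC rcompM rcompXn mulrA.
by rewrite mulrCA e mulrC.
Qed.

Lemma iter_y2D_comp (B : K) n (g : nat -> K) m (w : {poly K}) :
  w != 0 -> w - 'X * w^`() = B%:P ->
  let v := tofrac 'X / tofrac w in
  iter n (@y2D K) (rcomp (\sum_(i < m) g i *: 'X^(i.+1)) v) =
  rcomp (\sum_(i < m) (g i * B ^+ n * ((i + n) ^_ n)%:R) *: 'X^((i + n).+1)) v.
Proof.
move=> w0 we v; elim: n => [|n IH].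
  by congr rcomp; apply: eq_bigr => i _; rewrite addn0 ffactn0 !mulr1.
rewrite iterS IH (y2D_comp _ w0 we); congr rcomp.
rewrite raddf_sum /= mulr_sumr scaler_sumr; apply: eq_bigr => i _.
rewrite derivZ derivXn /= -scalerAr !scalerA addnS ffactSS natrM.
rewrite -['X^(i + n) *+ _]scaler_nat -scalerAr scalerA -exprD; congr (_ *: _); rewrite exprS; ring.
Qed.

End RationalFunctionTheory.

(** * Polynomial dependence on the parameters A and B *)

Section UniformFamilies.
Variable K : fieldType.
Implicit Types (f g : K -> K -> K) (p q : K -> K -> {poly K}).

(** The order of quantifiers is the point: one polynomial serves all A and B. Closure under the ring
    operations then lets explicit formulas be recognized as such families. *)
Definition upol f := exists P : {poly {poly K}}, forall A B, P.[A, B] = f A B.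

Definition uspec p := exists P : {poly {poly {poly K}}}, forall A B, spec2 P A B = p A B.

Lemma spec2E (P : {poly {poly {poly K}}}) A B :
  spec2 P A B = map_poly (horner_eval B \o horner_eval A%:P) P.
Proof. by []. Qed.

Lemma upol_cst c : upol (fun _ _ => c).
Proof. by exists c%:P%:P => A B; rewrite !hornerC. Qed.

Lemma upol_fst : upol (fun A _ => A).
Proof. by exists 'X => A B; rewrite hornerX hornerC. Qed.

Lemma upol_snd : upol (fun _ B => B).
Proof. by exists 'X%:P => A B; rewrite hornerC hornerX. Qed.

Lemma upolD f g : upol f -> upol g -> upol (fun A B => f A B + g A B).
Proof. by move=> [P fP] [Q gQ]; exists (P + Q) => A B; rewrite !hornerD fP gQ. Qed.

Lemma upolM f g : upol f -> upol g -> upol (fun A B => f A B * g A B).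
Proof. by move=> [P fP] [Q gQ]; exists (P * Q) => A B; rewrite !hornerM fP gQ. Qed.

Lemma upolX f n : upol f -> upol (fun A B => f A B ^+ n).
Proof. by move=> [P fP]; exists (P ^+ n) => A B; rewrite !horner_exp fP. Qed.

Lemma upol_sum n (P : pred 'I_n) (f : 'I_n -> K -> K -> K) : (forall i, upol (f i)) ->
  upol (fun A B => \sum_(i < n | P i) f i A B).
Proof.
move=> /boolp.choice[Q fQ]; exists (\sum_(i < n | P i) Q i) => A B.
by rewrite !horner_sum; apply: eq_bigr => i _; rewrite fQ.
Qed.

Lemma upol_prod n (P : pred 'I_n) (f : 'I_n -> K -> K -> K) : (forall i, upol (f i)) ->
  upol (fun A B => \prod_(i < n | P i) f i A B).
Proof.
move=> /boolp.choice[Q fQ]; exists (\prod_(i < n | P i) Q i) => A B.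
by rewrite !horner_prod; apply: eq_bigr => i _; rewrite fQ.
Qed.

Lemma upol_coef p i : uspec p -> upol (fun A B => (p A B)`_i).
Proof.
move=> [P pP]; exists P`_i => A B; rewrite -pP spec2E coef_map; by [].
Qed.

Lemma uspecC f : upol f -> uspec (fun A B => (f A B)%:P).
Proof. by move=> [P fP]; exists P%:P => A B; rewrite spec2E map_polyC /= -fP. Qed.

Lemma uspec_cst (c : {poly K}) : uspec (fun _ _ => c).
Proof.
exists (map_poly (polyC \o polyC) c) => A B; rewrite spec2E.
by apply/polyP => i; rewrite !coef_map /= /horner_eval !hornerC.
Qed.

Lemma uspecD p q : uspec p -> uspec q -> uspec (fun A B => p A B + q A B).
Proof. by move=> [P fP] [Q gQ]; exists (P + Q) => A B; rewrite -fP -gQ !spec2E rmorphD. Qed.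

Lemma uspecM p q : uspec p -> uspec q -> uspec (fun A B => p A B * q A B).
Proof. by move=> [P fP] [Q gQ]; exists (P * Q) => A B; rewrite -fP -gQ !spec2E rmorphM. Qed.

Lemma uspecX p n : uspec p -> uspec (fun A B => p A B ^+ n).
Proof. by move=> [P fP]; exists (P ^+ n) => A B; rewrite -fP !spec2E rmorphXn. Qed.

Lemma uspec_sum n (p : 'I_n -> K -> K -> {poly K}) : (forall i, uspec (p i)) ->
  uspec (fun A B => \sum_(i < n) p i A B).
Proof.
move=> /boolp.choice[Q fQ]; exists (\sum_(i < n) Q i) => A B.
by rewrite spec2E rmorph_sum; apply: eq_bigr => i _; rewrite -fQ.
Qed.

End UniformFamilies.

(** * The modulus as a real number, and real estimates *)

Section Modulus.
Variable R : realType.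
Local Notation C := (Cplx R).
Implicit Types x y z : C.

(** The norm takes its values in the complex numbers; passing to [cmod] makes real arithmetic, and
    its decision procedures, available for all later bounds. *)
Lemma norm_cmod z : `|z| = (cmod z)%:C%C :> R[i].
Proof. exact: (normc_def (z : R[i])). Qed.

Lemma cmod_inj_norm z (r : R) : `|z| = r%:C%C :> R[i] -> cmod z = r.
Proof. by rewrite norm_cmod => -[]. Qed.

Lemma cmod_ge0 z : 0 <= cmod z.
Proof. exact: sqrtr_ge0. Qed.

Lemma cmodM x y : cmod (x * y) = cmod x * cmod y.
Proof. by apply: cmod_inj_norm; rewrite normrM !norm_cmod -rmorphM. Qed.

Lemma cmodN x : cmod (- x) = cmod x.
Proof. by apply: cmod_inj_norm; rewrite normrN norm_cmod. Qed.

Lemma cmodD x y : cmod (x + y) <= cmod x + cmod y.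
Proof. by have := ler_normD x y; rewrite !norm_cmod -rmorphD lecR. Qed.

Lemma cmod_nat n : cmod (n%:R : C) = n%:R.
Proof. by apply: cmod_inj_norm; rewrite normr_nat rmorph_nat. Qed.

Lemma cmod0 : cmod (0 : C) = 0.
Proof. exact: (cmod_nat 0). Qed.

Lemma cmod1 : cmod (1 : C) = 1.
Proof. exact: (cmod_nat 1). Qed.

Lemma cmod_eq0 x : (cmod x == 0) = (x == 0).
Proof.
apply/eqP/eqP => [x0|->]; last exact: cmod0.
by apply/eqP; rewrite -normr_eq0 norm_cmod x0.
Qed.

Lemma cmodX x n : cmod (x ^+ n) = cmod x ^+ n.
Proof. by elim: n => [|n IH]; rewrite ?expr0 ?cmod1// !exprS cmodM IH. Qed.

Lemma cmodV x : cmod x^-1 = (cmod x)^-1.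
Proof. by apply: cmod_inj_norm; rewrite normfV norm_cmod fmorphV. Qed.

Lemma cmod_sign n : cmod ((-1) ^+ n : C) = 1.
Proof. by rewrite cmodX cmodN cmod1 expr1n. Qed.

Lemma cmodB x y : cmod (x - y) = cmod (y - x).
Proof. by rewrite -cmodN opprB. Qed.

Lemma cmod_sum n (F : nat -> C) : cmod (\sum_(i < n) F i) <= \sum_(i < n) cmod (F i).
Proof.
elim: n => [|n IH]; first by rewrite !big_ord0 cmod0.
by rewrite !big_ord_recr /= (le_trans (cmodD _ _))// lerD2r.
Qed.

Lemma sqr_cmod z : cmod z ^+ 2 = cre z ^+ 2 + cim z ^+ 2.
Proof. by rewrite sqr_sqrtr// addr_ge0 ?sqr_ge0. Qed.

Lemma cre_le z : `|cre z| <= cmod z.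
Proof. by rewrite -sqrtr_sqr ler_sqrt ?addr_ge0 ?sqr_ge0// lerDl sqr_ge0. Qed.

Lemma cim_le z : `|cim z| <= cmod z.
Proof. by rewrite -sqrtr_sqr ler_sqrt ?addr_ge0 ?sqr_ge0// lerDr sqr_ge0. Qed.

Lemma cmod_le z : cmod z <= `|cre z| + `|cim z|.
Proof.
have h : 0 <= `|cre z| + `|cim z| by rewrite addr_ge0.
rewrite -(ger0_norm h) -sqrtr_sqr ler_sqrt ?sqr_ge0//.
rewrite sqrrD !real_normK ?num_real// addrAC lerDl mulrn_wge0// mulr_ge0//.
Qed.

Lemma creD x y : cre (x + y) = cre x + cre y.
Proof. by case: x => a b; case: y. Qed.

Lemma cimD x y : cim (x + y) = cim x + cim y.
Proof. by case: x => a b; case: y. Qed.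

Lemma creM x y : cre (x * y) = cre x * cre y - cim x * cim y.
Proof. by case: x => a b; case: y. Qed.

Lemma cimM x y : cim (x * y) = cre x * cim y + cim x * cre y.
Proof. by case: x => a b; case: y. Qed.

Lemma creN x : cre (- x) = - cre x.
Proof. by case: x. Qed.

Lemma cimN x : cim (- x) = - cim x.
Proof. by case: x. Qed.

Lemma cplx_ext x y : cre x = cre y -> cim x = cim y -> x = y.
Proof. by case: x => a b; case: y => c d /= ; rewrite /cre /cim /= => -> ->. Qed.

End Modulus.

Section SineCosineBounds.
Variable R : realType.
Implicit Types x y : R.

Lemma sin_abs_le x : `|sin x| <= `|x|.
Proof.
wlog x0 : x / 0 <= x => [h|].
  have [/h//|x0] := leP 0 x.
  by have := h (- x); rewrite sinN !normrN oppr_ge0; apply; apply: ltW.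
have [c _] := MVT_segment x0 (fun x _ => is_derive_sin x)
  (continuous_subspaceT (@continuous_sin R)).
rewrite sin0 !subr0 => ->; rewrite normrM ler_piMl// cos_max//.
Qed.

Lemma cos_sub1_abs_le x : `|cos x - 1| <= x ^+ 2.
Proof.
wlog x0 : x / 0 <= x => [h|].
  have [/h//|x0] := leP 0 x.
  by rewrite -cosN -sqrrN h// oppr_ge0 ltW.
have [c] := MVT_segment x0 (fun x _ => is_derive_cos x)
  (continuous_subspaceT (@continuous_cos R)).
rewrite in_itv /= cos0 subr0 => /andP[c0 cx] ->.
rewrite normrM normrN (ger0_norm x0) expr2 ler_wpM2r//.
by rewrite (le_trans (sin_abs_le c))// ger0_norm.
Qed.

Lemma sin_subx_abs_le x : `|x| <= 1 -> `|sin x - x| <= x ^+ 2.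
Proof.
wlog x0 : x / 0 <= x => [h|].
  have [/h//|x0] := leP 0 x => x1.
  by have := h (- x); rewrite sinN sqrrN -opprD !normrN oppr_ge0; apply => //; apply: ltW.
rewrite ger0_norm// => x1.
have D (t : R) : is_derive t 1 (sin \- id) (cos t - 1).
  exact: is_deriveB.
have cont : continuous (sin \- id : R -> R).
  by move=> t; apply: continuousB; [exact: continuous_sin | exact: cvg_id].
have [c] := MVT_segment x0 (fun x _ => D x) (continuous_subspaceT cont).
rewrite in_itv /= sin0 !subr0 => /andP[c0 cx] e.
have -> : sin x - x = (cos c - 1) * x by exact: e.
rewrite normrM (ger0_norm x0) expr2 ler_wpM2r//.
rewrite (le_trans (cos_sub1_abs_le c))//.
by nra.
Qed.

(** Only 1 + x <= exp x is used, at x and at - x: the latter gives exp x <= 1 / (1 - x), which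
    exceeds 1 + x by x^2 / (1 - x) <= 2 x^2. *)
Lemma expR_taylor_bound x : `|x| <= 2^-1 -> `|expR x - 1 - x| <= 2 * x ^+ 2.
Proof.
rewrite ler_norml => /andP[x1 x2].
have h1 := expR_ge1Dx x; have h2 := expR_ge1Dx (- x); have h3 := expR_gt0 x.
have h4 : expR x * (1 - x) <= 1.
  by rewrite -[leRHS](expRxMexpNx_1 x) ler_pM2l.
rewrite ler_norml; apply/andP; split; nra.
Qed.

End SineCosineBounds.

(** * Complex exponential and principal logarithm *)

Section ExpLog.
Variable R : realType.
Local Notation C := (Cplx R).
Implicit Types x y z u v : C.

Lemma cre_cexp u : cre (cexp u) = expR (cre u) * cos (cim u).
Proof. by []. Qed.

Lemma cim_cexp u : cim (cexp u) = expR (cre u) * sin (cim u).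
Proof. by []. Qed.

Lemma cexpD u v : cexp (u + v) = cexp u * cexp v.
Proof.
apply: cplx_ext; rewrite ?creM ?cimM !cre_cexp !cim_cexp creD cimD expRD ?cosD ?sinD; ring.
Qed.

Lemma cexp0 : cexp (0 : C) = 1.
Proof. by apply: cplx_ext; rewrite /cre /cim /= expR0 ?cos0 ?sin0 ?mulr1 ?mulr0. Qed.

Lemma cmod_cexp u : cmod (cexp u) = expR (cre u).
Proof.
rewrite /cmod cre_cexp cim_cexp !exprMn -mulrDr cos2Dsin2 mulr1 sqrtr_sqr.
by rewrite ger0_norm ?expR_ge0.
Qed.

Lemma cexp_neq0 u : cexp u != 0.
Proof. by rewrite -cmod_eq0 cmod_cexp gt_eqF ?expR_gt0. Qed.

Lemma cexpN u : cexp (- u) = (cexp u)^-1.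
Proof.
by apply: (mulfI (cexp_neq0 u)); rewrite -cexpD subrr cexp0 divff ?cexp_neq0.
Qed.

Lemma cexpMn u n : cexp (n%:R * u) = cexp u ^+ n.
Proof.
elim: n => [|n IH]; first by rewrite mul0r cexp0.
by rewrite -natr1 mulrDl mul1r cexpD IH exprSr.
Qed.

Lemma cexp_taylor_bound u : cmod u <= 2^-1 -> cmod (cexp u - 1 - u) <= 4 * cmod u ^+ 2.
Proof.
move=> u1; apply: le_trans (cmod_le _) _; rewrite sqr_cmod !creD !cimD !creN !cimN.
rewrite cre_cexp cim_cexp -[cre 1]/(1 : R) -[cim 1]/(0 : R) subr0.
have := le_trans (cre_le u) u1; have := le_trans (cim_le u) u1.
move: (cre u) (cim u) => {u1} a b b1 a1.
have b1' : `|b| <= 1 by apply: (le_trans b1); lra.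
have he := expR_taylor_bound a1; have hc := cos_sub1_abs_le b.
have hs := sin_subx_abs_le b1'; have hs' := sin_abs_le b.
have cm := cos_max b; have sm := sin_max b.
(* Both parts are regrouped into terms of second order. With |b| <= 1/2 they add up to at most 3 a^2
   + 5/2 b^2 + |a b|, which is below 4 (a^2 + b^2). *)
have -> : expR a * cos b - 1 - a = (expR a - 1 - a) * cos b + (1 + a) * (cos b - 1) by ring.
have -> : expR a * sin b - b = (expR a - 1 - a) * sin b + a * sin b + (sin b - b) by ring.
have h1 : `|(expR a - 1 - a) * cos b| <= 2 * a ^+ 2.
  by rewrite normrM (le_trans (ler_pM _ _ he cm)) ?mulr1.
have h2 : `|(1 + a) * (cos b - 1)| <= 3 / 2 * b ^+ 2.
  rewrite normrM; apply: ler_pM => //; apply: le_trans (ler_normD _ _) _.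
  by rewrite normr1; lra.
have h3 : `|(expR a - 1 - a) * sin b| <= 2 * a ^+ 2 * `|b|.
  by rewrite normrM; apply: ler_pM.
have h4 : `|a * sin b| <= `|a| * `|b| by rewrite normrM; apply: ler_pM.
apply: le_trans (lerD (ler_normD _ _) (ler_normD _ _)) _.
apply: le_trans (lerD (lerD h1 h2) (lerD (ler_normD _ _) hs)) _.
apply: le_trans (lerD (lexx _) (lerD (lerD h3 h4) (lexx _))) _.
rewrite -[in a ^+ 2]real_normK ?num_real// -[b ^+ 2]real_normK ?num_real//.
have := normr_ge0 a; have := normr_ge0 b.
move: `|a| `|b| a1 b1 => p q p1 q1 q0 p0.
have h5 : 0 <= p ^+ 2 * (2^-1 - q) by rewrite mulr_ge0 ?sqr_ge0 ?subr_ge0.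
by have h6 := sqr_ge0 (p - q); have := sqr_ge0 q; have := sqr_ge0 p; nra.
Qed.

Lemma clogK u : `|cim u| < pi -> clog (cexp u) = u.
Proof.
rewrite ltr_norml => /andP[u1 u2]; apply: cplx_ext.
  by rewrite {1}/cre /clog /= cmod_cexp expRK.
rewrite {1}/cim /clog /= /carg cmod_cexp cre_cexp cim_cexp.
rewrite mulrAC divff ?gt_eqF ?expR_gt0// mul1r pmulr_rge0 ?expR_gt0//.
have [u0|u0] := leP 0 (cim u).
  by rewrite sin_ge0_pi ?u0 ?ltW// cosK// in_itv /= u0 ltW.
have -> : (0 <= sin (cim u)) = false.
  apply/negbTE; rewrite -ltNge -oppr_gt0 -sinN sin_gt0_pi//.
  by rewrite oppr_gt0 u0 ltrNl.
by rewrite cosKN ?opprK// ltW// ltW.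
Qed.

Lemma cre_div_cmod y : -1 <= cre y / cmod y <= 1.
Proof.
rewrite -ler_norml normrM normfV (ger0_norm (cmod_ge0 y)).
have [->|y0] := eqVneq (cmod y) 0; first by rewrite invr0 mulr0.
by rewrite ler_pdivrMr ?mul1r ?cre_le// lt_neqAle eq_sym y0 cmod_ge0.
Qed.

Lemma clog_exp y : y != 0 -> cexp (clog y) = y.
Proof.
rewrite -cmod_eq0 => y0.
have yp : 0 < cmod y by rewrite lt_neqAle eq_sym y0 cmod_ge0.
have xb := cre_div_cmod y.
have cc : cos (carg y) = cre y / cmod y.
  by rewrite /carg; case: ifP => _; rewrite ?cosN acosK// in_itv.
apply: cplx_ext; rewrite ?cre_cexp ?cim_cexp {1}/cre {1}/cim /= lnK ?posrE//.
  by rewrite cc mulrC mulfVK.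
have s : cmod y * Num.sqrt (1 - (cre y / cmod y) ^+ 2) = `|cim y|.
  rewrite -{1}(ger0_norm (cmod_ge0 y)) -sqrtr_sqr -sqrtrM ?sqr_ge0// -[RHS]sqrtr_sqr.
  congr Num.sqrt; rewrite mulrBr mulr1 expr_div_n mulrCA divff ?expf_neq0//.
  by rewrite mulr1 sqr_cmod; ring.
rewrite /carg; case: (leP 0 (cim y)) => i0; rewrite ?sinN sin_acos// ?mulrN s.
  by rewrite ger0_norm.
by rewrite ltr0_norm// opprK.
Qed.

Lemma ln_abs_le (t : R) : `|t - 1| <= 2^-1 -> `|ln t| <= 2 * `|t - 1|.
Proof.
move=> h; have /andP[h1 h2] : - 2^-1 <= t - 1 <= 2^-1 by rewrite -ler_norml.
have t0 : 0 < t by lra.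
have l1 : ln t <= t - 1.
  by have := expR_ge1Dx (ln t); rewrite lnK ?posrE//; lra.
have l2 : 1 - ln t <= t^-1.
  by have := expR_ge1Dx (- ln t); rewrite expRN lnK ?posrE//; lra.
have l3 : (1 - ln t) * t <= 1 by rewrite -ler_pdivlMr// div1r.
rewrite ler_norml -[leLHS]mulrN; apply/andP; split.
  have := ler_norm (t - 1); have := ler_norm (- (t - 1)); rewrite normrN.
  by move=> ? ?; nra.
by have := ler_norm (t - 1); have := normr_ge0 (t - 1); lra.
Qed.

Lemma clog_small (e : R) : 0 < e ->
  exists2 d : R, 0 < d & forall y : C, cmod (y - 1) < d -> cmod (clog y) < e.
Proof.
move=> e0; pose t : R := Num.min (e / 2) 1.
have t0 : 0 < t by rewrite lt_min ltr01 divr_gt0.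
have te : t <= e / 2 by rewrite ge_min lexx.
have tpi : t <= pi.
  have : t <= 1 by rewrite ge_min lexx orbT.
  by have := @pi_ge2 R; lra.
have ct : cos t < 1.
  by rewrite -[ltRHS]cos0 ltr_cos ?in_itv /= ?lexx ?pi_ge0 ?(ltW t0).
have ct1 := cos_geN1 t.
(* 1/2 is the range of [ln_abs_le], and e / 4 then makes |ln |y|| < e / 2. The bound (1 - cos t) / 2
   gives cos t < Re y / |y|, hence |arg y| < t <= e / 2 as cosine decreases. *)
exists (Num.min (Num.min (2^-1) ((1 - cos t) / 2)) (e / 4)).
  by rewrite !lt_min invr_gt0 ltr0n !divr_gt0// subr_gt0.
move=> y; rewrite !lt_min => /andP[/andP[d1 d2] d3].
have hm : `|cmod y - 1| <= cmod (y - 1).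
  have h1 := cmodD (y - 1) 1; rewrite subrK cmod1 in h1.
  have h2 := cmodD (- (y - 1)) y; rewrite cmodN (_ : - (y - 1) + y = 1) in h2; last ring.
  by rewrite cmod1 in h2; rewrite ler_norml; lra.
have l : `|ln (cmod y)| < e / 2.
  apply: le_lt_trans (ln_abs_le (le_trans hm (ltW d1))) _.
  by have := hm; lra.
have yp : 0 < cmod y by move: hm; rewrite ler_norml => /andP[]; lra.
have hre : 1 - cmod (y - 1) <= cre y.
  have := cre_le (y - 1); rewrite creD creN -[cre 1]/(1 : R) ler_norml => /andP[]; lra.
have hx : cos t < cre y / cmod y.
  rewrite ltr_pdivlMr//; move: hm; rewrite ler_norml => /andP[_ h].
  have [c0|c0] := leP (cos t) 0; nra.
have xb := cre_div_cmod y.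
have a : `|carg y| < t.
  have -> : `|carg y| = acos (cre y / cmod y).
    by rewrite /carg; case: ifP => _; rewrite ?normrN ger0_norm ?acos_ge0.
  rewrite -ltr_cos ?in_itv /= ?acos_ge0 ?acos_lepi ?(ltW t0)//.
  by rewrite acosK ?in_itv.
apply: le_lt_trans (cmod_le _) _; rewrite /cre /cim /=.
have := lt_le_trans a te; move: l; lra.
Qed.

End ExpLog.

(** * Limits of complex sequences with real epsilons *)

Section Limits.
Variable R : realType.
Local Notation C := (Cplx R).
Implicit Types (u v : nat -> C) (l : C).

Lemma cplx_pos (e : C) : 0 < e -> exists2 r : R, 0 < r & e = r%:C%C.
Proof.
case: e => a b; rewrite (ltcE (0 : R[i])) /= => /andP[/eqP-> a0].
by exists a.
Qed.

Lemma cmod_ltP z (r : R) : (`|z : C| < (r%:C%C : C)) = (cmod z < r).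
Proof. by rewrite norm_cmod ltcR. Qed.

Lemma near_cplx (a : C) (P : C -> Prop) (d : R) :
  0 < d -> (forall z, cmod (z - a) < d -> P z) -> \forall z \near a, P z.
Proof.
move=> d0 H; apply/nbhs_ballP; exists (d%:C%C : C) => /=; first by rewrite ltcR.
by move=> z; rewrite /ball /= => h; apply: H; rewrite cmodB -cmod_ltP.
Qed.

Definition clim u l := forall e : R, 0 < e ->
  exists N, forall n, (N <= n)%N -> cmod (u n - l) < e.

Lemma clim_cvg u l : clim u l -> u @ \oo --> l.
Proof.
move=> ul; apply/cvgrPdist_lt => e /cplx_pos[r r0 ->].
have [N H] := ul r r0; exists N => // n /= Nn.
by rewrite cmod_ltP cmodB H.
Qed.

Lemma cvg_cplx (a l : C) (f : C -> C) :
  (forall e : R, 0 < e -> exists2 d : R, 0 < d &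
    forall z, cmod (z - a) < d -> cmod (f z - l) < e) ->
  f z @[z --> a] --> l.
Proof.
move=> H U /nbhs_ballP[e /= /cplx_pos[r r0 er] eU].
have [d d0 h] := H r r0; apply: (near_cplx d0) => z zd; apply: eU.
by rewrite /ball /= er cmod_ltP cmodB h.
Qed.

Lemma clim_unique u l l' : clim u l -> clim u l' -> l = l'.
Proof.
move=> h h'; apply/eqP; rewrite -subr_eq0 -cmod_eq0; apply/negPn/negP => n0.
have e0 : 0 < cmod (l - l') / 2 by rewrite divr_gt0// lt_neqAle eq_sym n0 cmod_ge0.
have [N hN] := h _ e0; have [N' hN'] := h' _ e0.
have := hN _ (leq_maxl N N'); have := hN' _ (leq_maxr N N').
set n := maxn _ _; have := cmodD (l - u n) (u n - l').
by rewrite subrKA [cmod (l - u n)]cmodB; lra.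
Qed.

Lemma clim_near u v l (d : nat -> R) : clim u l ->
  (forall e : R, 0 < e -> exists N, forall n, (N <= n)%N -> d n < e) ->
  (forall n, cmod (v n - u n) <= d n) -> clim v l.
Proof.
move=> ul d0 vu e e0; have e20 : 0 < e / 2 by rewrite divr_gt0.
have [N hN] := ul _ e20; have [N' hN'] := d0 _ e20.
exists (maxn N N') => n; rewrite geq_max => /andP[Nn N'n].
rewrite -(subrKA (u n)); apply: le_lt_trans (cmodD _ _) _.
by have := hN _ Nn; have := hN' _ N'n; have := vu n; lra.
Qed.

Lemma climZ c u l : clim u l -> clim (fun n => c * u n) (c * l).
Proof.
move=> ul e e0; have c0 : 0 < cmod c + 1 by rewrite ltr_wpDl ?cmod_ge0.
have [N hN] := ul (e / (cmod c + 1)) (divr_gt0 e0 c0).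
exists N => n /hN; rewrite ltr_pdivlMr// -mulrBr cmodM => h.
by have := cmod_ge0 (u n - l); nra.
Qed.

Lemma clim_cst l : clim (fun=> l) l.
Proof. by move=> e e0; exists 0%N => n _; rewrite subrr cmod0. Qed.

Lemma climD u v l l' : clim u l -> clim v l' -> clim (fun n => u n + v n) (l + l').
Proof.
move=> ul vl e e0; have e20 : 0 < e / 2 by rewrite divr_gt0.
have [N hN] := ul _ e20; have [N' hN'] := vl _ e20.
exists (maxn N N') => n; rewrite geq_max => /andP[/hN h /hN' h'].
by rewrite opprD addrACA; apply: le_lt_trans (cmodD _ _) _; lra.
Qed.

Lemma clim_sum m (U : nat -> nat -> C) (L : nat -> C) :
  (forall i, clim (U i) (L i)) ->
  clim (fun n => \sum_(i < m) U i n) (\sum_(i < m) L i).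
Proof.
move=> H; elim: m => [|m IH].
  by rewrite big_ord0 (_ : (fun _ => _) = fun=> 0) ?funeqE => [|n]; rewrite ?big_ord0//; apply: clim_cst.
rewrite big_ord_recr (_ : (fun _ => _) = fun n => \sum_(i < m) U i n + U m n).
  exact: climD.
by rewrite funeqE => n; rewrite big_ord_recr.
Qed.

Lemma clim_shift m u l : clim (fun n => u (n + m)%N) l -> clim u l.
Proof.
move=> h e /h[N H]; exists (N + m)%N => n Nn; rewrite -(subnK (leq_trans (leq_addl _ _) Nn)).
by apply: H; rewrite leq_subRL ?(leq_trans (leq_addl _ _) Nn) // addnC.
Qed.

(** q <= 1/4 supplies two factors 2^(-n): one absorbs n, the other is at most 1 / (n + 1). *)
Lemma natX_geometric_small (K q : R) : 0 <= q <= 4^-1 -> forall e : R, 0 < e ->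
  exists N, forall n, (N <= n)%N -> K * (n%:R * q ^+ n) < e.
Proof.
move=> /andP[q0 q4] e e0; exists (Num.truncn (`|K| / e)) => n Nn.
have h : n%:R * q ^+ n <= n.+1%:R^-1 :> R.
  have q' : q ^+ n <= (2 ^+ n)^-1 ^+ 2.
    by rewrite -exprVn -exprM mulnC exprM lerXn2r ?nnegrE// exprVn -natrX.
  have n2 : n.+1%:R <= 2 ^+ n :> R by rewrite -natrX ler_nat ltn_expl.
  have : (2 ^+ n)^-1 <= n.+1%:R^-1 :> R by rewrite lef_pV2 ?posrE ?exprn_gt0.
  have t0 : 0 < 2 ^+ n :> R by rewrite exprn_gt0.
  apply: le_trans; apply: le_trans (ler_wpM2l (ler0n _ _) q') _.
  rewrite expr2 mulrA ler_piMl ?invr_ge0 ?(ltW t0)// ler_pdivrMr// mul1r.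
  by apply: le_trans n2; rewrite ler_nat.
have n0 : 0 <= n%:R * q ^+ n :> R by rewrite mulr_ge0// exprn_ge0.
apply: le_lt_trans (ler_wpM2r n0 (ler_norm K)) _.
apply: le_lt_trans (ler_wpM2l (normr_ge0 K) h) _.
rewrite ltr_pdivrMr// mulrC -ltr_pdivrMr//.
by apply: lt_le_trans (Num.Theory.truncnS_gt _) _; rewrite ler_nat.
Qed.

End Limits.

(** * Geometrically dominated series and their products *)

Section Series.
Variable R : realType.
Local Notation C := (Cplx R).
Implicit Types (u v : nat -> C) (l z : C) (M q : R).

Lemma geometric_tail (f : nat -> R) M q : 0 <= q <= 2^-1 ->
  (forall k, `|f k| <= M * q ^+ k) ->
  forall N, `|limn (series f) - series f N| <= 2 * M * q ^+ N.
Proof.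
move=> /andP[q0 q2] fb N.
have q1 : `|q| < 1 by rewrite ger0_norm//; lra.
have M0 : 0 <= M by have := le_trans (normr_ge0 _) (fb 0%N); rewrite expr0 mulr1.
have cf : series f n @[n --> \oo] --> limn (series f).
  apply: normed_cvg; apply: series_le_cvg (is_cvg_geometric_series (a := M) q1) => //= n.
  by rewrite mulr_ge0// exprn_ge0.
(* For q <= 1/2 one has q^k <= 2 (q^k - q^(k+1)), so the bound telescopes. *)
have tail m : `|series f (N + m)%N - series f N| <= 2 * M * (q ^+ N - q ^+ (N + m)).
  elim: m => [|m IH]; first by rewrite addn0 !subrr normr0 mulr0.
  rewrite addnS (_ : series f (N + m).+1 = series f (N + m)%N + f (N + m)%N); last first.
    by rewrite /series /= big_nat_recr.
  rewrite addrAC.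
  apply: le_trans (ler_normD _ _) _; have := fb (N + m)%N.
  have qp : 0 <= q ^+ (N + m) by rewrite exprn_ge0.
  have : 0 <= M * q ^+ (N + m) * (2^-1 - q) by rewrite !mulr_ge0 ?subr_ge0.
  by rewrite exprS; lra.
apply/ler_addgt0Pr => e e0.
have /cvgrPdist_lt /(_ e e0)[n _ H] := cf.
have {H} := H (N + n)%N (leq_addl _ _); have := tail n.
have qp : 0 <= q ^+ (N + n) by rewrite exprn_ge0.
have h := ler_normD (limn (series f) - series f (N + n)%N) (series f (N + n)%N - series f N).
rewrite subrKA in h; move: h.
by have : 0 <= M * q ^+ (N + n); [rewrite mulr_ge0 | lra].
Qed.

(** Summation by real and imaginary parts gives access to the comparison test for real series. *)
Definition csum u : C :=
  (limn (series (fun k => cre (u k))) +i* limn (series (fun k => cim (u k))))%C.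

Lemma cre_sum n u : cre (\sum_(k < n) u k) = series (fun k => cre (u k)) n.
Proof.
elim: n => [|n IH]; first by rewrite /series /= big_ord0 big_geq.
by rewrite big_ord_recr creD IH /series /= big_nat_recr.
Qed.

Lemma cim_sum n u : cim (\sum_(k < n) u k) = series (fun k => cim (u k)) n.
Proof.
elim: n => [|n IH]; first by rewrite /series /= big_ord0 big_geq.
by rewrite big_ord_recr cimD IH /series /= big_nat_recr.
Qed.

Lemma csum_tail u M q : 0 <= q <= 2^-1 -> (forall k, cmod (u k) <= M * q ^+ k) ->
  forall N, cmod (csum u - \sum_(k < N) u k) <= 4 * M * q ^+ N.
Proof.
move=> q2 ub N; apply: le_trans (cmod_le _) _.
rewrite creD cimD creN cimN cre_sum cim_sum.
have h1 := geometric_tail q2 (fun k => le_trans (cre_le (u k)) (ub k)) N.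
have h2 := geometric_tail q2 (fun k => le_trans (cim_le (u k)) (ub k)) N.
by apply: le_trans (lerD h1 h2) _; rewrite -mulrDl -mulrDl -natrD.
Qed.

Lemma geometric_small (K q : R) : 0 <= q <= 2^-1 -> forall e : R, 0 < e ->
  exists N, forall n, (N <= n)%N -> K * q ^+ n < e.
Proof.
move=> /andP[q0 q2] e e0.
have q1 : `|q| < 1 by rewrite ger0_norm//; lra.
have /cvgrPdist_lt /(_ e e0)[N _ H] := cvg_geometric K q1.
exists N => n /H /=; rewrite sub0r normrN; exact/le_lt_trans/ler_norm.
Qed.

Lemma clim_csum u M q : 0 <= q <= 2^-1 -> (forall k, cmod (u k) <= M * q ^+ k) ->
  clim (fun N => \sum_(k < N) u k) (csum u).
Proof.
move=> q2 ub e e0; have [N H] := geometric_small (4 * M) q2 e0.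
by exists N => n /H; apply: le_lt_trans; rewrite cmodB csum_tail.
Qed.

Lemma csum_unique u l M q : 0 <= q <= 2^-1 -> (forall k, cmod (u k) <= M * q ^+ k) ->
  clim (fun N => \sum_(k < N) u k) l -> csum u = l.
Proof. by move=> q2 ub; apply: clim_unique; apply: clim_csum q2 ub. Qed.

Lemma csumZ c u M q : 0 <= q <= 2^-1 -> (forall k, cmod (u k) <= M * q ^+ k) ->
  csum (fun k => c * u k) = c * csum u.
Proof.
move=> q2 ub; apply: (csum_unique (M := cmod c * M) q2) => [k|].
  by rewrite cmodM -mulrA ler_wpM2l ?cmod_ge0.
rewrite (_ : (fun N => _) = fun N => c * \sum_(k < N) u k).
  exact: climZ (clim_csum q2 ub).
by rewrite funeqE => N; rewrite mulr_sumr.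
Qed.

Lemma csumD u v M M' q : 0 <= q <= 2^-1 -> (forall k, cmod (u k) <= M * q ^+ k) ->
  (forall k, cmod (v k) <= M' * q ^+ k) ->
  csum (fun k => u k + v k) = csum u + csum v.
Proof.
move=> q2 ub vb; apply: (csum_unique (M := M + M') q2) => [k|].
  by rewrite mulrDl (le_trans (cmodD _ _))// lerD.
rewrite (_ : (fun N => _) = fun N => \sum_(k < N) u k + \sum_(k < N) v k).
  by apply: climD; [exact: clim_csum q2 ub | exact: clim_csum q2 vb].
by rewrite funeqE => N; rewrite big_split.
Qed.

Lemma csum_recl u M q : 0 <= q <= 2^-1 -> (forall k, cmod (u k) <= M * q ^+ k) ->
  csum u = u 0%N + csum (fun k => u k.+1).
Proof.
move=> q2 ub; apply: (csum_unique q2 ub); apply: (clim_shift (m := 1)).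
have ub' k : cmod (u k.+1) <= (M * q) * q ^+ k by rewrite -mulrA -exprS.
have /(climD (clim_cst (u 0%N))) := clim_csum q2 ub'.
rewrite (_ : (fun n => _ + _) = fun n => \sum_(k < n + 1) u k)//.
by rewrite funeqE => n; rewrite addn1 big_ord_recl.
Qed.

Lemma sum_triangle (w : nat -> nat -> C) N :
  \sum_(k < N) \sum_(r < k.+1) w r (k - r)%N = \sum_(r < N) \sum_(j < N - r) w r j.
Proof.
elim: N => [|N IH]; first by rewrite !big_ord0.
rewrite big_ord_recr IH [in RHS]big_ord_recr /= subSnn big_ord1.
rewrite [X in _ + X = _]big_ord_recr /= subnn addrA; congr (_ + _).
rewrite -big_split; apply: eq_bigr => r _.
by rewrite subSn ?big_ord_recr// ltnW.
Qed.

(** The triangular partial sum differs from the sum of the first n full rows by n row tails, each of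
    order q^n; the total error n q^n is why q <= 1/4 is asked. *)
Lemma clim_triangle (w : nat -> nat -> C) l M q : 0 <= q <= 4^-1 ->
  (forall r j, cmod (w r j) <= M * q ^+ (r + j)) ->
  clim (fun N => \sum_(r < N) csum (w r)) l ->
  clim (fun N => \sum_(k < N) \sum_(r < k.+1) w r (k - r)%N) l.
Proof.
move=> q4 wb sl; apply: clim_near sl (natX_geometric_small (4 * M) q4) _ => n.
rewrite sum_triangle -sumrB.
apply: le_trans (cmod_sum _ (fun r => \sum_(j < n - r) w r j - csum (w r))) _.
have q2 : 0 <= q <= 2^-1 by case/andP: q4 => -> ?; lra.
apply: (@le_trans _ _ (\sum_(r < n) 4 * M * q ^+ n)); last first.
  by rewrite sumr_const card_ord -mulr_natl; lra.
apply: ler_sum => r _; rewrite cmodB.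
have wb' j : cmod (w r j) <= (M * q ^+ r) * q ^+ j by rewrite -mulrA -exprD.
apply: le_trans (csum_tail q2 wb' _) _.
by rewrite mulrA -[X in X <= _]mulrA -exprD subnKC// ltnW.
Qed.

Lemma csum_cauchy u v M M' q : 0 <= q <= 4^-1 ->
  (forall k, cmod (u k) <= M * q ^+ k) -> (forall k, cmod (v k) <= M' * q ^+ k) ->
  csum (fun k => \sum_(r < k.+1) u r * v (k - r)%N) = csum u * csum v.
Proof.
move=> q4 ub vb.
have M0 : 0 <= M by have := le_trans (cmod_ge0 _) (ub 0%N); rewrite expr0 mulr1.
have q0 : 0 <= q by case/andP: q4.
have q2 : 0 <= q <= 2^-1 by case/andP: q4 => -> ?; lra.
(* The k-th Cauchy term has k + 1 summands of order q^k, and k + 1 <= 2^k gives the ratio 2 q. *)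
have qq : 0 <= 2 * q <= 2^-1 by case/andP: q4 => *; apply/andP; split; lra.
have wb r j : cmod (u r * v j) <= M * M' * q ^+ (r + j).
  by rewrite cmodM exprD mulrACA ler_pM ?cmod_ge0.
apply: (csum_unique (M := M * M') qq) => [k|].
  apply: le_trans (cmod_sum _ (fun r => u r * v (k - r)%N)) _.
  apply: (@le_trans _ _ (\sum_(r < k.+1) M * M' * q ^+ k)).
    apply: ler_sum => r _; apply: le_trans (wb _ _) _.
    by rewrite subnKC// -ltnS.
  rewrite sumr_const card_ord exprMn mulrCA -[leLHS]mulr_natl.
  have MM : 0 <= M * M' * q ^+ k by have := le_trans (cmod_ge0 _) (wb 0%N k).
  by apply: (ler_wpM2r MM); rewrite -natrX ler_nat ltn_expl.
apply: (clim_triangle (w := fun r j => u r * v j) q4 wb).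
rewrite (_ : (fun N => _) = fun N => csum v * \sum_(r < N) u r).
  by rewrite mulrC; apply: climZ (clim_csum q2 ub).
rewrite funeqE => N; rewrite mulr_sumr; apply: eq_bigr => r _.
by rewrite (csumZ _ q2 vb) mulrC.
Qed.

End Series.

(** * Geometric bounds on the coefficients *)

Section CoefficientBounds.
Variable R : realType.
Local Notation C := (Cplx R).
Implicit Types (x h A B : C) (m n k b : nat).

Lemma bin_le_exp2 n k : ('C(n, k) <= 2 ^ n)%N.
Proof.
elim: n k => [|n IH] [|k]; rewrite ?bin0 ?expn_gt0//.
by rewrite binS expnS mul2n -addnn leq_add.
Qed.

Lemma bin_succ_succ m k :
  'C(m + k.+1, k.+1)%:R = 'C(m + k, k)%:R * (m + k).+1%:R / k.+1%:R :> R.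
Proof.
apply: (canRL (mulfK _)); first by rewrite pnatr_eq0.
by rewrite -!natrM addnS mulnC -mul_bin_diag mulnC.
Qed.

Lemma cbin_bound x m k : cmod x <= m%:R -> cmod (cbin x k) <= 'C(m + k, k)%:R.
Proof.
move=> xm; elim: k => [|k IH]; first by rewrite cbin0 cmod1 bin0.
rewrite cbinS 2!cmodM cmodV cmod_nat bin_succ_succ ler_wpM2r ?invr_ge0//.
apply: ler_pM; rewrite ?cmod_ge0//; apply: le_trans (cmodD _ _) _.
by rewrite cmodN cmod_nat -natr1 natrD; lra.
Qed.

Lemma cbin_lipschitz x h m k : cmod x <= m%:R -> cmod h <= 1 ->
  cmod (cbin (x + h) k - cbin x k) <= cmod h * 'C(m.+1 + k, k)%:R.
Proof.
move=> xm h1; elim: k => [|k IH].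
  by rewrite !cbin0 subrr cmod0 mulr_ge0 ?cmod_ge0.
have -> : cbin (x + h) k.+1 - cbin x k.+1 =
    ((cbin (x + h) k - cbin x k) * (x + h - k%:R) + cbin x k * h) / k.+1%:R.
  by rewrite !cbinS; ring.
rewrite cmodM cmodV cmod_nat bin_succ_succ !mulrA ler_wpM2r ?invr_ge0//.
apply: le_trans (cmodD _ _) _.
rewrite [cmod (_ * (x + h - _))]cmodM [cmod (_ * h)]cmodM.
have l : cmod (x + h - k%:R) <= (m.+1 + k)%:R.
  have := cmodD (x + h) (- k%:R); have := cmodD x h.
  by rewrite cmodN cmod_nat natrD -[m.+1%:R]natr1; lra.
have bl : cmod (cbin x k) <= 'C(m.+1 + k, k)%:R.
  by apply: le_trans (cbin_bound k xm) _; rewrite ler_nat leq_bin2l// leq_add2r.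
have e1 := ler_pM (cmod_ge0 _) (cmod_ge0 _) IH l.
have e2 := ler_wpM2r (cmod_ge0 h) bl.
by rewrite -[(m.+1 + k).+1%:R]natr1 mulrDr mulr1; lra.
Qed.

(** The quotient (a_k(x) - a_k(0)) / x without a division by x, hence meaningful at 0;
    [raney_slope B k 0] is the coefficient of z^k in log y. *)
Definition raney_slope B k x : C :=
  if k is k'.+1 then cbin (x + B * k%:R - 1) k' / k%:R else 0.

Lemma raney_slopeE B k x : raney B k x = (k == 0)%N%:R + x * raney_slope B k x.
Proof. by case: k => [|k] /=; rewrite ?mulr0 ?addr0// add0r mulrAC mulrA. Qed.

Lemma raney_argument_bound B b k x n : cmod B <= b%:R -> cmod x <= n%:R ->
  cmod (x + B * k%:R - 1) <= (n + b * k + 1)%:R.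
Proof.
move=> Bb xn; apply: le_trans (cmodD _ _) _; rewrite cmodN cmod1 !natrD lerD2r.
apply: le_trans (cmodD _ _) _; rewrite lerD// cmodM cmod_nat natrM.
by rewrite ler_wpM2r.
Qed.

(** At index k + 1 the binomial is dominated by one with upper entry (n + b (k + 1) + 1) + k = n +
    (b + 1) (k + 1), and a binomial is at most 2 to its upper entry. *)
Lemma raney_slope_bound B b k x n : cmod B <= b%:R -> cmod x <= n%:R ->
  cmod (raney_slope B k x) <= 2 ^+ n * (2 ^+ b.+1) ^+ k.
Proof.
move=> Bb xn; case: k => [|k]; first by rewrite cmod0 mulr_ge0 ?exprn_ge0.
rewrite cmodM cmodV cmod_nat ler_pdivrMr ?ltr0n//.
apply: le_trans (cbin_bound _ (raney_argument_bound _ Bb xn)) _.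
apply: (@le_trans _ _ (2 ^+ n * 2 ^+ b.+1 ^+ k.+1)); last first.
  by rewrite ler_peMr ?ler1n ?mulr_ge0 ?exprn_ge0.
by rewrite -exprM -exprD -natrX ler_nat (leq_trans (bin_le_exp2 _ _))// leq_exp2l//; lia.
Qed.

Lemma raney_slope_lipschitz B b k h : cmod B <= b%:R -> cmod h <= 1 ->
  cmod (raney_slope B k h - raney_slope B k 0) <= cmod h * (2 * (2 ^+ b.+1) ^+ k).
Proof.
move=> Bb h1; case: k => [|k].
  by rewrite subrr cmod0 !mulr_ge0 ?cmod_ge0 ?exprn_ge0.
rewrite /raney_slope -mulrBl cmodM cmodV cmod_nat ler_pdivrMr ?ltr0n//.
have x0 : cmod (0 : C) <= 0%:R by rewrite cmod0.
have := cbin_lipschitz k (raney_argument_bound k.+1 Bb x0) h1.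
have -> : 0 + B * k.+1%:R - 1 + h = h + B * k.+1%:R - 1 by ring.
move=> /le_trans; apply; rewrite -mulrA ler_wpM2l ?cmod_ge0//.
apply: (@le_trans _ _ (2 * 2 ^+ b.+1 ^+ k.+1)); last first.
  by rewrite ler_peMr ?ler1n ?mulr_ge0 ?exprn_ge0.
by rewrite -exprM -exprS -natrX ler_nat (leq_trans (bin_le_exp2 _ _))// leq_exp2l//; lia.
Qed.

Lemma raney_bound B b k x n : cmod B <= b%:R -> cmod x <= n%:R ->
  cmod (raney B k x) <= 4 ^+ n * (2 ^+ b.+1) ^+ k.
Proof.
move=> Bb xn; case: k => [|k]; first by rewrite /raney cmod1 expr0 mulr1 -natrX ler1n expn_gt0.
rewrite raney_slopeE add0r cmodM.
have -> : 4 ^+ n = 2 ^+ n * 2 ^+ n :> R by rewrite -exprMn -natrM.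
rewrite -mulrA.
apply: ler_pM; rewrite ?cmod_ge0//; last exact: raney_slope_bound.
by apply: le_trans xn _; rewrite -natrX ler_nat ltnW// ltn_expl.
Qed.

Lemma nat_bound x : exists n, cmod x <= n%:R.
Proof. by exists (Num.truncn (cmod x)).+1; apply/ltW/Num.Theory.truncnS_gt. Qed.

Lemma power_near1 (w : C) (e : R) n : cmod (w - 1) <= e -> n%:R * e <= 2^-1 ->
  cmod (w ^+ n - 1) <= 2 * (n%:R * e).
Proof.
move=> we; have e0 := le_trans (cmod_ge0 _) we.
elim: n => [|n IH] ne; first by rewrite expr0 subrr cmod0 mul0r mulr0.
have ne' : n%:R * e <= 2^-1.
  by apply: le_trans ne; rewrite ler_wpM2r// ler_nat.
have {}IH := IH ne'.
have -> : w ^+ n.+1 - 1 = w ^+ n * (w - 1) + (w ^+ n - 1) by rewrite exprSr; ring.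
apply: le_trans (cmodD _ _) _; rewrite cmodM -natr1.
have w2 : cmod (w ^+ n) <= 2.
  by have := cmodD (w ^+ n - 1) 1; rewrite subrK cmod1; lra.
by have := ler_pM (cmod_ge0 _) (cmod_ge0 _) w2 we; lra.
Qed.

End CoefficientBounds.

(** * The series for y^A and its identification with the principal power *)

Section GeneralizedBinomialSeries.
Variables (R : realType) (B : Cplx R) (b : nat).
Hypothesis Bb : cmod B <= b%:R.
Local Notation C := (Cplx R).
Implicit Types (A h z : C).

Definition raney_series z A : C := csum (fun k => raney B k A * z ^+ k).
Definition raney_log z : C := csum (fun k => raney_slope B k 0 * z ^+ k).

Variable z : C.
Let q : R := 2 ^+ b.+1 * cmod z.
Hypothesis q4 : q <= 4^-1.

Let q0 : 0 <= q.
Proof. by rewrite mulr_ge0 ?exprn_ge0 ?cmod_ge0. Qed.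

Let q04 : 0 <= q <= 4^-1. Proof. by rewrite q0 q4. Qed.

Let q02 : 0 <= q <= 2^-1.
Proof. by rewrite q0 (le_trans q4)// lef_pV2 ?posrE// ler_nat. Qed.

Let term_bound (c : nat -> C) M k : cmod (c k) <= M * (2 ^+ b.+1) ^+ k ->
  cmod (c k * z ^+ k) <= M * q ^+ k.
Proof. by move=> cb; rewrite cmodM cmodX exprMn mulrA ler_wpM2r ?exprn_ge0 ?cmod_ge0. Qed.

Lemma raney_term_bound A n k : cmod A <= n%:R ->
  cmod (raney B k A * z ^+ k) <= 4 ^+ n * q ^+ k.
Proof. by move=> An; apply: (term_bound (c := fun k => raney B k A)); apply: raney_bound. Qed.

Lemma raney_series0 : raney_series z 0 = 1.
Proof.
have b0 : cmod (0 : C) <= 0%:R by rewrite cmod0.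
apply: (csum_unique q02 (fun k => raney_term_bound k b0)).
apply: (clim_shift (m := 1)); rewrite (_ : (fun n => _) = fun=> 1); first exact: clim_cst.
rewrite funeqE => n; rewrite addn1 big_ord_recl big1 ?addr0 ?raney0 ?mulr1// => i _.
by rewrite raney0 mul0r.
Qed.

Lemma raney_seriesD A A' :
  raney_series z (A + A') = raney_series z A * raney_series z A'.
Proof.
have [n An] := nat_bound A; have [n' An'] := nat_bound A'.
rewrite /raney_series -(csum_cauchy q04 (fun k => raney_term_bound k An)
  (fun k => raney_term_bound k An')).
congr csum; rewrite funeqE => k; rewrite -raneyD mulr_suml; apply: eq_bigr => r _.
have rk : (r <= k)%N by rewrite -ltnS.
have -> : z ^+ k = z ^+ r * z ^+ (k - r) by rewrite -exprD subnKC.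
by ring.
Qed.

Lemma raney_seriesMn A n : raney_series z (n%:R * A) = raney_series z A ^+ n.
Proof.
elim: n => [|n IH]; first by rewrite mul0r raney_series0.
by rewrite -natr1 mulrDl mul1r raney_seriesD IH exprSr.
Qed.

Lemma raney_series_eq : raney_series z 1 = 1 + z * raney_series z B.
Proof.
have b1 : cmod (1 : C) <= 1%:R by rewrite cmod1.
rewrite /raney_series (csum_recl q02 (fun k => raney_term_bound k b1)).
rewrite mulr1; congr (_ + _); have [n Bn] := nat_bound B.
rewrite -(csumZ z q02 (fun k => raney_term_bound k Bn)); congr csum.
rewrite funeqE => k; rewrite -[in X in raney B k.+1 X](add0r 1) raneyS raney0 !add0r.
by rewrite exprS; ring.
Qed.

Lemma raney_series_near1 A n : cmod A <= n%:R ->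
  cmod (raney_series z A - 1) <= 4 * 4 ^+ n * q.
Proof.
move=> An; have := csum_tail q02 (fun k => raney_term_bound k An) 1.
by rewrite big_ord1 mulr1 expr1.
Qed.

Let slope_bound A n : cmod A <= n%:R ->
  forall k, cmod (raney_slope B k A * z ^+ k) <= 2 ^+ n * q ^+ k.
Proof.
move=> An k; apply: (term_bound (c := fun k => raney_slope B k A)).
exact: raney_slope_bound.
Qed.

Let zero_bound : cmod (0 : C) <= 0%:R. Proof. by rewrite cmod0. Qed.

Lemma raney_log_bound : cmod (raney_log z) <= 4 * q.
Proof.
have := csum_tail q02 (slope_bound zero_bound) 1.
by rewrite big_ord1 mul0r subr0 expr0 mulr1 expr1.
Qed.

(** For fixed z, this is the expansion of y^h to first order in the exponent. The remainder is h
    times a series whose terms are O(h) by the Lipschitz bound on the slopes; 8 is the 4 of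
    [csum_tail] times the 2 of that bound. *)
Lemma raney_series_slope h : cmod h <= 1 ->
  cmod (raney_series z h - 1 - h * raney_log z) <= 8 * cmod h ^+ 2.
Proof.
move=> h1; have h1' : cmod h <= 1%:R by [].
have lb k : cmod ((raney_slope B k h - raney_slope B k 0) * z ^+ k) <=
    cmod h * 2 * q ^+ k.
  apply: (term_bound (c := fun k => raney_slope B k h - raney_slope B k 0)).
  by rewrite -mulrA; apply: raney_slope_lipschitz.
have e : raney_series z h = 1 + h * (raney_log z +
    csum (fun k => (raney_slope B k h - raney_slope B k 0) * z ^+ k)).
  rewrite -(csumD q02 (slope_bound zero_bound) lb).
  rewrite [in RHS](_ : (fun k => _ + _) = fun k => raney_slope B k h * z ^+ k); last first.
    by rewrite funeqE => k; ring.
  rewrite /raney_series (csum_recl q02 (fun k => raney_term_bound k h1')).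
  rewrite (csum_recl q02 (slope_bound h1')) mul0r add0r mulr1.
  have sb k : cmod (raney_slope B k.+1 h * z ^+ k.+1) <= 2 ^+ 1 * q * q ^+ k.
    by rewrite -mulrA -exprS; apply: slope_bound.
  rewrite -(csumZ h q02 sb); congr (1 + csum _).
  by rewrite funeqE => k; rewrite raney_slopeE add0r mulrA.
rewrite e; set s := csum _ in e *.
have -> : 1 + h * (raney_log z + s) - 1 - h * raney_log z = h * s by ring.
have := csum_tail q02 lb 0; rewrite big_ord0 subr0 expr0 mulr1 cmodM.
by have := cmod_ge0 h; have := cmod_ge0 s; rewrite -/s; nra.
Qed.

(* The multiplicative function [phi A = y ^ A exp (- A log y)] is
   [1 + O(A ^ 2)], and [phi A = phi (A / n) ^ n]. *)
Lemma raney_series_exp A : raney_series z A = cexp (A * raney_log z).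
Proof.
set L := raney_log z; have L1 : cmod L <= 1.
  by apply: le_trans raney_log_bound _; move: q4; rewrite -(ler_pM2l (ltr0n R 4)); lra.
pose phi h := raney_series z h * cexp (- (h * L)).
suff phi1 : phi A = 1.
  move: phi1; rewrite /phi cexpN => /(canRL (mulfK _)).
  by rewrite invr_eq0 cexp_neq0 invrK mul1r; apply.
(* 48 = (8 + 4) * 4: the two second-order remainders, times a bound for [cexp (- (h * L))]. *)
have phi_small h : cmod h <= 2^-1 -> cmod (phi h - 1) <= 48 * cmod h ^+ 2.
  move=> h2; have h1 : cmod h <= 1 by apply: le_trans h2 _; lra.
  have hL : cmod (h * L) <= cmod h by rewrite cmodM ler_piMr ?cmod_ge0.
  have hL2 : cmod (h * L) <= 2^-1 by apply: le_trans hL _.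
  have e1 := raney_series_slope h1; have e2 := cexp_taylor_bound hL2.
  have -> : phi h - 1 = (raney_series z h - cexp (h * L)) * cexp (- (h * L)).
    by rewrite /phi mulrBl -cexpD subrr cexp0.
  have e3 : cmod (raney_series z h - cexp (h * L)) <= 12 * cmod h ^+ 2.
    have -> : raney_series z h - cexp (h * L) =
       (raney_series z h - 1 - h * L) - (cexp (h * L) - 1 - h * L) by ring.
    apply: le_trans (cmodD _ _) _; rewrite cmodN.
    have : cmod (h * L) ^+ 2 <= cmod h ^+ 2 by rewrite lerXn2r ?nnegrE ?cmod_ge0.
    by rewrite -/L in e1; lra.
  have e4 : cmod (cexp (- (h * L))) <= 4.
    have hN : cmod (- (h * L)) <= 2^-1 by rewrite cmodN.
    have f2 := cexp_taylor_bound hN; rewrite opprK in f2.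
    have f1 := cmodD (cexp (- (h * L)) - 1 + h * L) (1 - h * L).
    rewrite (_ : _ + (1 - h * L) = cexp (- (h * L))) in f1; last by ring.
    have f3 : cmod (1 - h * L) <= 1 + 2^-1.
      by apply: le_trans (cmodD _ _) _; rewrite cmod1 lerD2l.
    have f4 : cmod (- (h * L)) ^+ 2 <= 4^-1.
      have := cmod_ge0 (- (h * L)); move: hN; move: (cmod _) => t t1 t0; nra.
    by lra.
  rewrite cmodM; apply: le_trans (ler_pM (cmod_ge0 _) (cmod_ge0 _) e3 e4) _.
  by have := sqr_ge0 (cmod h); lra.
have phiMn h n : phi (n%:R * h) = phi h ^+ n.
  rewrite /phi raney_seriesMn exprMn; congr (_ * _).
  by rewrite -cexpMn; congr cexp; ring.
apply: (clim_unique (u := fun=> phi A)); first exact: clim_cst.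
move=> e e0; pose a := cmod A.
(* The three summands ensure, in turn, |A / n| <= 1/2, the smallness n * 48 (a / n)^2 <= 1/2
   required by [power_near1], and a final bound below [e]. *)
exists (Num.truncn (2 * a + 96 * a ^+ 2 + 96 * a ^+ 2 / e)).+1 => n nN.
have a0 : 0 <= a := cmod_ge0 A.
have aa : 0 <= 96 * a ^+ 2 by rewrite mulr_ge0 ?sqr_ge0.
have ae : 0 <= 96 * a ^+ 2 / e by rewrite divr_ge0// ltW.
have nR : 2 * a + 96 * a ^+ 2 + 96 * a ^+ 2 / e < n%:R.
  by apply: lt_le_trans (Num.Theory.truncnS_gt _) _; rewrite ler_nat.
have n0 : 0 < n%:R :> R by lra.
have nC : n%:R != 0 :> C by rewrite pnatr_eq0 -lt0n -(ltr0n R).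
have -> : A = n%:R * (A / n%:R) by rewrite mulrC mulfVK.
have cA : cmod (A / n%:R) = a / n%:R by rewrite cmodM cmodV cmod_nat.
have an2 : cmod (A / n%:R) <= 2^-1.
  by rewrite cA ler_pdivrMr//; lra.
have := phi_small _ an2; rewrite cA => small.
have ne : n%:R * (48 * (a / n%:R) ^+ 2) = 48 * a ^+ 2 / n%:R.
  by field; rewrite gt_eqF.
have := power_near1 (n := n) small; rewrite ne -phiMn => P.
apply: le_lt_trans (P _) _; first by rewrite ler_pdivrMr//; lra.
have -> : 2 * (48 * a ^+ 2 / n%:R) = 96 * a ^+ 2 / n%:R by field; rewrite gt_eqF.
rewrite ltr_pdivrMr// -ltr_pdivrMl// mulrC.
by apply: le_lt_trans nR; lra.
Qed.

(** As [raney_log z] has modulus at most 1 < pi, it lies in the strip where the principal logarithm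
    inverts the exponential. *)
Lemma clog_raney_series : clog (raney_series z 1) = raney_log z.
Proof.
rewrite raney_series_exp mul1r clogK//.
apply: le_lt_trans (cim_le _) _; apply: le_lt_trans raney_log_bound _.
by have := @pi_ge2 R; move: q4; rewrite -(ler_pM2l (ltr0n R 4)); lra.
Qed.

Lemma cpow_raney_series A : cpow (raney_series z 1) A = raney_series z A.
Proof. by rewrite /cpow clog_raney_series raney_series_exp. Qed.

Lemma raney_series_neq0 A : raney_series z A != 0.
Proof. by rewrite raney_series_exp cexp_neq0. Qed.

Lemma raney_series_solves :
  raney_series z 1 - 1 - z * cpow (raney_series z 1) B = 0.
Proof. by rewrite cpow_raney_series raney_series_eq; ring. Qed.

Lemma raney_series_t : (1 - raney_series z 1) / raney_series z 1 =
  - z * raney_series z (B - 1).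
Proof.
apply: (mulIf (raney_series_neq0 1)); rewrite mulfVK ?raney_series_neq0//.
rewrite -mulrA -raney_seriesD subrK raney_series_eq; ring.
Qed.

End GeneralizedBinomialSeries.

(** * The branch near 1, and the passage from series in t to series in z *)

Section Solution.
Variables (R : realType) (B : Cplx R).
Local Notation C := (Cplx R).
Implicit Types (A z y : C).

Let bE : {b | cmod B <= b%:R}.
Proof. exact: boolp.cid (nat_bound B). Qed.
Let b := sval bE.
Let Bb : cmod B <= b%:R := svalP bE.

Let K : R := 2 ^+ b.+1.
Let K0 : 0 < K. Proof. exact: exprn_gt0. Qed.

Definition solution z : C := raney_series B z 1.

Let K_small z (d : R) : cmod z < d / K -> K * cmod z <= d.
Proof. by rewrite ltr_pdivlMr// mulrC => /ltW. Qed.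

Lemma solution_cvg : solution z @[z --> (0 : C)] --> (1 : C).
Proof.
(* [raney_series_near1] with n = 1 bounds the distance to 1 by 16 K |z|, which e / 32 makes at most
   e / 2. *)
apply: cvg_cplx => e e0; exists (Num.min 4^-1 (e / 32) / K).
  by rewrite divr_gt0// lt_min invr_gt0 ltr0n divr_gt0.
move=> z; rewrite subr0 => /K_small; rewrite le_min => /andP[z4 ze].
have b1 : cmod (1 : C) <= 1%:R by rewrite cmod1.
by apply: le_lt_trans (raney_series_near1 Bb z4 b1) _; rewrite /K in ze *; lra.
Qed.

(* In the coordinate [u = log y], the map [y ^ B] is Lipschitz near [1], so
   [y - y' = z (y ^ B - y' ^ B)] forces [y = y'] when [z] is small. *)
Lemma cpow_injective_near1 : exists2 d : R, 0 < d &
  exists2 r : R, 0 < r & forall z y y', cmod z < r ->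
    cmod (y - 1) < d -> cmod (y' - 1) < d ->
    y - 1 - z * cpow y B = 0 -> y' - 1 - z * cpow y' B = 0 -> y = y'.
Proof.
pose c : R := cmod B + 1; have c1 : 1 <= c by rewrite lerDr cmod_ge0.
have c0 : 0 < c by apply: lt_le_trans c1.
(* With both logarithms below 1 / (16 c), [h] and [B * h] have modulus at most 1/8, where
   [cexp v - 1] has modulus between |v| / 2 and 2 |v|. *)
have [d d0 dP] := @clog_small R (16 * c)^-1 (ltac:(by rewrite invr_gt0 mulr_gt0)).
exists (Num.min d 1); first by rewrite lt_min d0 ltr01.
exists (32 * c)^-1; first by rewrite invr_gt0 mulr_gt0.
move=> z y y' zr; rewrite !lt_min => /andP[yd y1] /andP[y'd y'1].
have nz (w : C) : cmod (w - 1) < 1 -> w != 0.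
  by apply: contraTneq => ->; rewrite sub0r cmodN cmod1 ltxx.
rewrite /cpow -{1}(clog_exp (nz _ y1)) -{1}(clog_exp (nz _ y'1)) => e e'.
rewrite -(clog_exp (nz _ y1)) -(clog_exp (nz _ y'1)).
move: (dP _ yd) (dP _ y'd) e e'; move: (clog y) (clog y') => u u' us u's e e'.
rewrite -[16]/(16%:R) in us u's.
have ci : (16 * c)^-1 * (16 * c) = 1 by rewrite mulVf// gt_eqF// mulr_gt0.
have ci0 : 0 < (16 * c)^-1 by rewrite invr_gt0 mulr_gt0.
set h := u - u'.
have hs : cmod h <= 2 * (16 * c)^-1.
  by rewrite /h; apply: le_trans (cmodD _ _) _; rewrite cmodN; lra.
have ic : (16 * c)^-1 <= 16^-1 by rewrite lef_pV2 ?posrE ?mulr_gt0//; lra.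
have cB : cmod B <= c by rewrite /c; lra.
have small (v : C) : cmod v <= 2 * (16 * c)^-1 -> cmod (B * v) <= 8^-1.
  move=> vs; rewrite cmodM; apply: le_trans (ler_pM (cmod_ge0 _) (cmod_ge0 _) cB vs) _.
  by lra.
have expm1 (v : C) : cmod v <= 8^-1 ->
    2^-1 * cmod v <= cmod (cexp v - 1) <= 2 * cmod v.
  move=> v8; have v2 : cmod v <= 2^-1 by lra.
  have := cexp_taylor_bound v2; have := cmodD (cexp v - 1 - v) v.
  have := cmodD (cexp v - 1) (- (cexp v - 1 - v)); rewrite cmodN.
  rewrite subrK (_ : _ - (cexp v - 1 - v) = v); last by ring.
  by have := cmod_ge0 v; move=> ? ? ? ?; apply/andP; split; nra.
have exp_bound (v : C) : cmod v <= 8^-1 -> 2^-1 <= cmod (cexp v) <= 2.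
  move=> v8; have /andP[_ h1] := expm1 v v8.
  have h2 := cmodD (cexp v - 1) 1; rewrite subrK cmod1 in h2.
  have h3 := cmodD (- (cexp v - 1)) (cexp v).
  rewrite cmodN (_ : - _ + _ = 1) in h3; last by ring.
  by rewrite cmod1 in h3; apply/andP; split; lra.
have key : cexp u' * (cexp h - 1) = z * (cexp (B * u') * (cexp (B * h) - 1)).
  have hu : cexp u = cexp u' * cexp h by rewrite -cexpD /h addrC subrK.
  have hBu : cexp (B * u) = cexp (B * u') * cexp (B * h).
    by rewrite -cexpD -mulrDr /h addrC subrK.
  rewrite [LHS]mulrBr [in RHS]mulrBr !mulr1 -hu -hBu mulrBr.
  have -> : cexp u - cexp u' = (cexp u - 1 - z * cexp (B * u))
     - (cexp u' - 1 - z * cexp (B * u')) + (z * cexp (B * u) - z * cexp (B * u')) by ring.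
  by rewrite e e' subrr add0r.
have /andP[h1 _] := expm1 h (ltac:(lra)).
have /andP[u1 _] := exp_bound u' (ltac:(lra)).
have /andP[_ Bu] := exp_bound (B * u') (small u' (ltac:(lra))).
have /andP[_ Bh] := expm1 (B * h) (small _ hs).
have := congr1 (@cmod R) key; rewrite !cmodM => key'.
(* In [key] the left side is at least |h| / 4, while |z| < 1 / (32 c) makes the right side at most
   |h| / 8; hence h = 0. *)
have l : 4^-1 * cmod h <= cmod (cexp u') * cmod (cexp h - 1).
  have := ler_pM (ltac:(lra) : 0 <= 2^-1 :> R)
    (mulr_ge0 (ltac:(lra) : 0 <= 2^-1 :> R) (cmod_ge0 h)) u1 h1.
  by lra.
have r : cmod z * (cmod (cexp (B * u')) * cmod (cexp (B * h) - 1)) <= 8^-1 * cmod h.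
  have t1 := ler_pM (cmod_ge0 _) (cmod_ge0 _) Bu Bh.
  have t2 := ler_pM (cmod_ge0 _) (mulr_ge0 (cmod_ge0 _) (cmod_ge0 _)) (ltW zr) t1.
  apply: le_trans t2 _; rewrite cmodM.
  have t3 := ler_wpM2r (cmod_ge0 h) cB.
  have i0 : 0 <= (32 * c)^-1 by rewrite invr_ge0 mulr_ge0 ?ltW.
  have t4 := ler_wpM2l i0 t3.
  have e32 : (32 * c)^-1 * (c * cmod h) = 32^-1 * cmod h.
    by field; rewrite gt_eqF.
  by rewrite e32 in t4; lra.
have h0 : cmod h == 0 by rewrite eq_le cmod_ge0 andbT; rewrite key' in l; lra.
by rewrite cmod_eq0 subr_eq0 in h0; rewrite (eqP h0).
Qed.

Lemma solution_near1P : solution_near1 B solution.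
Proof.
split; first exact: solution_cvg.
have [d d0 [r r0 inj]] := cpow_injective_near1.
exists [set y | cmod (y - 1) < d]; first exact: (near_cplx d0).
apply: (@near_cplx _ _ _ (Num.min r (Num.min 4^-1 (d / 32) / K))).
  by rewrite lt_min r0 divr_gt0// lt_min invr_gt0 ltr0n divr_gt0.
move=> z; rewrite subr0 lt_min => /andP[zr /K_small]; rewrite le_min => /andP[z4 zd].
have solves := raney_series_solves Bb z4.
move=> y /= yd; split => [ysol|->]; last exact: solves.
apply: (inj z) => //; have b1 : cmod (1 : C) <= 1%:R by rewrite cmod1.
by apply: le_lt_trans (raney_series_near1 Bb z4 b1) _; rewrite /K in zd *; lra.
Qed.

(** Each y^A t^r equals (- z)^r y^(A + (B - 1) r), whose expansion in z is a row of a double series.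
    Its row sums give the series in t, and its antidiagonals, by [bin_transformK], the coefficients
    in z. *)
Lemma clim_bin_transform A (f : nat -> C) (M K1 : R) :
  0 <= K1 -> (forall r, cmod (bin_transform B A f r) <= M * K1 ^+ r) ->
  exists2 d : R, 0 < d & forall z, cmod z < d -> forall S,
    clim (fun N => \sum_(r < N) bin_transform B A f r *
            ((1 - solution z) / solution z) ^+ r) S ->
    clim (fun N => \sum_(k < N) f k * cbin (A + B * k%:R) k * z ^+ k)
         (cpow (solution z) A * S).
Proof.
move=> K10 fb; have M0 : 0 <= M.
  by have := le_trans (cmod_ge0 _) (fb 0%N); rewrite expr0 mulr1.
have [a Aa] := nat_bound A; have [c Bc] := nat_bound (B - 1).
(* The ratio is [K1 * 4 ^+ c] along r, since the exponent A + (B - 1) r grows with r, and [K] along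
   j; [K2] dominates both. *)
pose K2 : R := K1 * 4 ^+ c + K.
have K2K : K <= K2 by rewrite lerDr mulr_ge0 ?exprn_ge0.
have K1K : K1 * 4 ^+ c <= K2 by rewrite lerDl ltW.
have K20 : 0 < K2 by apply: lt_le_trans K0 K2K.
exists (4^-1 / K2); first by rewrite divr_gt0.
move=> z; rewrite ltr_pdivlMr// mulrC => /ltW z4 S clS.
have q0 : 0 <= K2 * cmod z by rewrite mulr_ge0 ?cmod_ge0 ?ltW.
have q4 : 0 <= K2 * cmod z <= 4^-1 by rewrite q0.
have Kz4 : K * cmod z <= 4^-1 by apply: le_trans z4; rewrite ler_wpM2r ?cmod_ge0.
have q'4 : 0 <= K * cmod z <= 2^-1.
  by rewrite mulr_ge0 ?cmod_ge0 ?(ltW K0)//=; lra.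
rewrite /solution (cpow_raney_series Bb Kz4) -/(solution z).
pose g r := (-1) ^+ r * bin_transform B A f r * z ^+ r.
pose w r j := g r * (raney B j (A + (B - 1) * r%:R) * z ^+ j).
have Ar r : cmod (A + (B - 1) * r%:R) <= (a + c * r)%:R.
  apply: le_trans (cmodD _ _) _; rewrite natrD lerD// cmodM cmod_nat natrM.
  by rewrite ler_wpM2r.
have wb r j : cmod (w r j) <= M * 4 ^+ a * (K2 * cmod z) ^+ (r + j).
  rewrite /w cmodM; apply: (@le_trans _ _ ((M * K1 ^+ r * cmod z ^+ r) *
      (4 ^+ (a + c * r) * (K * cmod z) ^+ j))).
    apply: ler_pM; rewrite ?cmod_ge0//; last exact: raney_term_bound.
    by rewrite /g cmodM cmodM cmod_sign mul1r cmodX ler_wpM2r ?exprn_ge0 ?cmod_ge0.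
  rewrite [4 ^+ (a + _)]exprD exprM [leRHS](_ : _ = M * 4 ^+ a * (K2 * cmod z) ^+ r * (K2 * cmod z) ^+ j); last first.
    by rewrite exprD mulrA.
  rewrite [leLHS](_ : _ = M * 4 ^+ a * (K1 * 4 ^+ c * cmod z) ^+ r * (K * cmod z) ^+ j); last first.
    by rewrite !exprMn; ring.
  have z0 := cmod_ge0 z.
  apply: ler_pM; rewrite ?mulr_ge0 ?exprn_ge0 ?mulr_ge0 ?exprn_ge0 ?(ltW K0)//.
    rewrite ler_wpM2l ?mulr_ge0 ?exprn_ge0// lerXn2r ?nnegrE ?mulr_ge0 ?exprn_ge0 ?(ltW K20)//.
    by rewrite ler_wpM2r.
  by rewrite lerXn2r ?nnegrE ?mulr_ge0 ?(ltW K20) ?(ltW K0)// ler_wpM2r.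
have cw r : csum (w r) = raney_series B z A *
    (bin_transform B A f r * ((1 - solution z) / solution z) ^+ r).
  rewrite /w (csumZ (g r) q'4 (fun k => raney_term_bound Bb z k (Ar r))).
  rewrite -/(raney_series B z _) (raney_seriesD Bb Kz4) [(B - 1) * _]mulrC.
  rewrite (raney_seriesMn Bb Kz4) /solution (raney_series_t Bb Kz4) exprMn.
  by rewrite /g [(- z) ^+ r]exprNn; ring.
have := clim_triangle (w := w) (l := raney_series B z A * S) q4 wb.
rewrite (_ : (fun N => _) = fun N => raney_series B z A *
    \sum_(r < N) bin_transform B A f r * ((1 - solution z) / solution z) ^+ r); last first.
  by rewrite funeqE => N; rewrite mulr_sumr; apply: eq_bigr => r _; rewrite cw.
move=> /(_ (climZ _ clS)); congr (clim _ _); rewrite funeqE => N.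
apply: eq_bigr => k _; rewrite -bin_transformK mulr_suml; apply: eq_bigr => r _.
have rk : (r <= k)%N by rewrite -ltnS.
have -> : z ^+ k = z ^+ r * z ^+ (k - r) by rewrite -exprD subnKC.
by rewrite /w /g; ring.
Qed.

End Solution.

(** * Assembling the rational function *)

Section Assembly.
Variable R : realType.
Local Notation C := (Cplx R).
Local Notation tofrac := (@FracField.tofrac {poly C}).
Implicit Types (A B x y z t : C) (n m k s : nat).

(** The partial sums satisfy (1 - x) S_(p+1)(N) = S_p(N) - binomial(N + p, p + 1) x^N, and the last
    term tends to 0; this carries the induction on p from the geometric series. *)
Lemma clim_negative_binomial p x : cmod x <= 8^-1 ->
  clim (fun N => \sum_(r < N) 'C(r + p, p)%:R * x ^+ r) ((1 - x)^-1 ^+ p.+1).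
Proof.
move=> x8; have x1 : 1 - x != 0.
  rewrite subr_eq0; apply: contraTneq x8 => <-; rewrite cmod1 -ltNge invf_lt1// ltr1n//.
have q0 : 0 <= 2 * cmod x <= 2^-1.
  by rewrite mulr_ge0 ?cmod_ge0//=; lra.
elim: p => [|p IH].
  have := climZ (1 - x)^-1 (clim_near (clim_cst 1) (geometric_small 1 q0)
    (v := fun N => 1 - x ^+ N) _).
  rewrite expr1 mulr1 => H.
  rewrite (_ : (fun N => _) = fun N => (1 - x)^-1 * (1 - x ^+ N)).
    apply: H => N; rewrite addrC addKr cmodN cmodX mul1r.
    by rewrite lerXn2r ?nnegrE ?mulr_ge0 ?cmod_ge0// ler_peMl ?cmod_ge0// ler1n.
  rewrite funeqE => N; apply: (mulfI x1); rewrite mulVKf//.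
  rewrite -[RHS]opprB subrX1 -mulNr opprB; congr (_ * _).
  by apply: eq_bigr => r _; rewrite bin0 mul1r.
have e0 (N : nat) : cmod ('C(N + p, p.+1)%:R * x ^+ N) <= 2 ^+ p * (2 * cmod x) ^+ N.
  rewrite cmodM cmod_nat cmodX exprMn mulrA ler_wpM2r ?exprn_ge0 ?cmod_ge0//.
  by rewrite -exprD addnC -natrX ler_nat bin_le_exp2.
rewrite exprS.
rewrite (_ : (fun N => _) = fun N => (1 - x)^-1 *
    (\sum_(r < N) 'C(r + p, p)%:R * x ^+ r - 'C(N + p, p.+1)%:R * x ^+ N)).
  apply: climZ; apply: clim_near IH (geometric_small (2 ^+ p) q0) _ => N.
  by rewrite addrC addKr cmodN.
rewrite funeqE => N; apply: (mulfI x1); rewrite mulVKf//.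
elim: N => [|N IHN]; first by rewrite !big_ord0 add0n bin_small// mul0r subrr mulr0.
have e1 : 'C(N + p.+1, p.+1)%:R = 'C(N + p, p.+1)%:R + 'C(N + p, p)%:R :> C.
  by rewrite addnS binS natrD.
have e2 : 'C(N.+1 + p, p.+1)%:R = 'C(N + p, p.+1)%:R + 'C(N + p, p)%:R :> C.
  by rewrite addSn binS natrD.
rewrite [in LHS]big_ord_recr [in RHS]big_ord_recr /= e1 e2 exprS [LHS]mulrDr IHN.
ring.
Qed.

Lemma small_quotient (K d : R) : 0 <= K -> 0 < d ->
  exists2 e : R, 0 < e & forall y, cmod (y - 1) < e ->
    y != 0 /\ K * cmod ((1 - y) / y) <= d.
Proof.
move=> K0 d0; have c0 : 0 < 2 * K + 1 by lra.
exists (Num.min 2^-1 (d / (2 * K + 1))); first by rewrite lt_min invr_gt0 ltr0n divr_gt0.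
move=> y; rewrite lt_min => /andP[y2 yd].
have yn : 2^-1 <= cmod y.
  have := cmodD (- (y - 1)) y; rewrite cmodN (_ : - _ + _ = 1); last by ring.
  by rewrite cmod1; lra.
have y0 : 0 < cmod y by lra.
split => //; first by rewrite -cmod_eq0 gt_eqF.
rewrite cmodM cmodV cmodB mulrA ler_pdivrMr//.
move: yd; rewrite ltr_pdivlMr// => yd; have := cmod_ge0 (y - 1); nra.
Qed.

(** * The two expansions, for either sign of l *)

Section AnalyticPart.
Variables (l : int) (A B : C) (F : {fraction {poly C}}).
Hypothesis fl0 : fl l A B 0 = 1.
Hypothesis fhat_bound : exists M K1 : R,
  0 <= K1 /\ forall r, cmod (fhat l A B r) <= M * K1 ^+ r.
Hypothesis fhat_sum : exists2 d : R, 0 < d & forall y, cmod (y - 1) < d ->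
  clim (fun N => \sum_(r < N) fhat l A B r * ((1 - y) / y) ^+ r) (reval F y).

Lemma series_in_t : \forall y \near (1 : C),
  (fun n : nat => \sum_(0 <= r < n) fhat l A B r * ((1 - y) / y) ^+ r) @ \oo
    --> reval F y.
Proof.
have [d d0 H] := fhat_sum; apply: (near_cplx d0) => y yd.
under boolp.eq_fun do rewrite big_mkord.
exact/clim_cvg/H.
Qed.

Lemma series_in_z : exists2 Y : C -> C, solution_near1 B Y &
  \forall z \near (0 : C),
    (fun n : nat => 1 + \sum_(1 <= k < n)
       fl l A B k * cbin (A + B * k%:R) k * z ^+ k) @ \oo
    --> cpow (Y z) A * reval F (Y z).
Proof.
have [d d0 H] := fhat_sum; have [M [K1 [K10 bnd]]] := fhat_bound.
exists (solution B); first exact: solution_near1P.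
have [e e0 T] := clim_bin_transform K10 bnd.
have near1 : \forall z \near (0 : C), cmod (solution B z - 1) < d.
  apply: (@solution_cvg R B [set y | cmod (y - 1) < d]).
  exact: (near_cplx d0).
have near0 : \forall z \near (0 : C), cmod z < e.
  by apply: (near_cplx e0) => z; rewrite subr0.
(* The shift makes the term k = 0 present in every partial sum; by [fl0] it is the isolated 1 of the
   statement. *)
near=> z; apply/clim_cvg/(clim_shift (m := 1)).
have ze : cmod z < e by near: z.
have yd : cmod (solution B z - 1) < d by near: z.
have := T z ze _ (H _ yd) => + eps eps0 => /(_ eps eps0)[N HN].
exists N => n Nn; have := HN (n + 1)%N (leq_trans Nn (leq_addr _ _)).
rewrite addn1 -(big_mkord predT (fun k => fl l A B k * cbin (A + B * k%:R) k * z ^+ k)).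
by rewrite big_ltn// fl0 cbin0 expr0 !mul1r.
Unshelve. all: by end_near. Qed.

End AnalyticPart.

(** The least exponent k is recorded as well as the degree: k = 0 for l <= 0, k = n + 1 for F when l
    = n + 1, and k = 1 for its n-fold antiderivative under y^2 D. *)
Definition block_poly (h : nat -> C) k s : {poly C} :=
  \sum_(j < s.+1) h j *: 'X^(k + j).

Lemma size_block_poly h k s : h s != 0 -> size (block_poly h k s) = (k + s).+1.
Proof.
move=> hs; rewrite /block_poly big_ord_recr /= addrC size_polyDl size_scale// size_polyXn//.
rewrite ltnS; apply: leq_trans (size_sum _ _ _) _; apply/bigmax_leqP => j _.
by apply: leq_trans (size_scale_leq _ _) _; rewrite size_polyXn -addnS leq_add2l.
Qed.

Lemma horner_block_poly h k s v :
  (block_poly h k s).[v] = \sum_(j < s.+1) h j * v ^+ (k + j).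
Proof. by rewrite horner_sum; apply: eq_bigr => j _; rewrite hornerZ hornerXn. Qed.

Lemma homogenize_block h k s (a b : {poly C}) :
  homogenize (k + s) (block_poly h k s) a b =
  \sum_(j < s.+1) h j *: (a ^+ (k + j) * b ^+ (s - j)).
Proof.
rewrite /homogenize; under eq_bigr => i _ do rewrite coef_sum scaler_suml.
rewrite exchange_big; apply: eq_bigr => j _.
have js : (j <= s)%N by rewrite -ltnS.
have kj : (k + j < (k + s).+1)%N by rewrite ltnS leq_add2l.
rewrite (bigD1 (Ordinal kj)) //= coefZ coefXn eqxx mulr1 subnDl big1 ?addr0//.
move=> i ij; rewrite coefZ coefXn [(i == k + j :> nat)%N](_ : _ = false) ?mulr0 ?scale0r//.
exact: negbTE ij.
Qed.

(** The coefficients [h j] may have denominators in A and B; [dl] is a common one and [hh j] are the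
    cleared numerators. Homogenizing in a and b then gives P and Q independent of A and B. *)
Lemma uniform_fraction k s (good : C -> C -> Prop) (a b : C -> C -> {poly C})
    (h hh : nat -> C -> C -> C) (dl : C -> C -> C) :
  uspec a -> uspec b -> upol dl -> (forall j, upol (hh j)) ->
  (forall A B, good A B -> [/\ b A B != 0, dl A B != 0 &
     forall j, (j <= s)%N -> dl A B * h j A B = hh j A B]) ->
  exists P Q : {poly {poly {poly C}}}, forall A B, good A B ->
    spec2 Q A B != 0 /\
    tofrac (spec2 P A B) / tofrac (spec2 Q A B) =
      rcomp (block_poly (fun j => h j A B) k s) (tofrac (a A B) / tofrac (b A B)).
Proof.
move=> ua ub ud uh H.
have [Q QE] : uspec (fun A B => (dl A B)%:P * b A B ^+ (k + s)).
  by apply: uspecM; [exact: uspecC | exact: uspecX].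
have [P PE] : uspec (fun A B => \sum_(j < s.+1)
    (hh j A B)%:P * (a A B ^+ (k + j) * b A B ^+ (s - j))).
  apply: uspec_sum => j; apply: uspecM; first exact: uspecC.
  by apply: uspecM; exact: uspecX.
exists P, Q => A B /H[b0 d0 hE]; rewrite QE PE; split.
  by rewrite mulf_neq0 ?polyC_eq0 ?expf_neq0.
have -> : \sum_(j < s.+1) (hh j A B)%:P * (a A B ^+ (k + j) * b A B ^+ (s - j)) =
    (dl A B)%:P * homogenize (k + s) (block_poly (fun j => h j A B) k s) (a A B) (b A B).
  rewrite homogenize_block mulr_sumr; apply: eq_bigr => j _.
  by rewrite -mul_polyC [RHS]mulrA -polyCM hE// -ltnS.
rewrite (rcomp_homogenize (N := k + s)) //; last first.
  apply: leq_trans (size_sum _ _ _) _; apply/bigmax_leqP => j _.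
  by apply: leq_trans (size_scale_leq _ _) _; rewrite size_polyXn ltnS leq_add2l -ltnS.
by rewrite !tofracM -mulf_div divff ?mul1r// tofrac_eq0 polyC_eq0.
Qed.

Lemma upol_linear c (k : nat) : upol (fun A B => A + B * k%:R + c).
Proof.
apply: upolD (upol_cst c); apply: upolD; first exact: upol_fst.
by apply: upolM; [exact: upol_snd | exact: upol_cst].
Qed.

Lemma upol_rising (f : C -> C -> C) n : upol f -> upol (fun A B => rising (f A B) n).
Proof. by move=> uf; apply: upol_prod => i; apply: upolD => //; apply: upol_cst. Qed.

Lemma upol_cbin (f : C -> C -> C) r : upol f -> upol (fun A B => cbin (f A B) r).
Proof.
move=> uf; apply: upolM; last exact: upol_cst.
by apply: upol_rising; do !(apply: upolD => //; last exact: upol_cst).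
Qed.

Section Nonpositive.
Variable m : nat.

Let D A B k := rising (A + B * k%:R - m%:R) m.+1.
Let good A B := forall k, D A B k != 0.

Lemma fl_defined_npos A B : fl_defined (- m%:Z) A B -> good A B.
Proof.
move=> [_ def] k; have := def (ltac:(by rewrite oppr_le0)) k.
by rewrite opprK -PoszD add1n rmorphN /= -pmulrn.
Qed.

Lemma fraction_npos : exists P Q : {poly {poly {poly C}}}, forall A B, good A B ->
  spec2 Q A B != 0 /\ tofrac (spec2 P A B) / tofrac (spec2 Q A B) =
    rcomp (block_poly (fhat (- m%:Z) A B) 0 m) (tofrac (1 - 'X) / tofrac 'X).
Proof.
have uD k : upol (fun A B => D A B k) by apply: upol_rising; apply: upol_linear.
(* [fl] at k is [D A B 0 / D A B k], and [fhat r] with r <= m involves only k <= m; so the product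
   of the [D A B i] for i <= m clears all denominators. *)
apply: (@uniform_fraction 0 m good (fun _ _ => 1 - 'X) (fun _ _ => 'X)
  (fun j A B => fhat (- m%:Z) A B j)
  (fun r A B => \sum_(k < r.+1) (-1) ^+ k * 'C(r, k)%:R * cbin (A + B * k%:R + 0) r *
     (D A B 0 * \prod_(i < m.+1 | i != k :> nat) D A B i))
  (fun A B => \prod_(i < m.+1) D A B i)).
- exact: uspec_cst.
- exact: uspec_cst.
- exact: upol_prod.
- move=> r; apply: upol_sum => k; apply: upolM; last first.
    by apply: upolM => //; apply: upol_prod.
  apply: upolM; first exact: upol_cst.
  by apply: upol_cbin; apply: upol_linear.
move=> A B g; split; first by rewrite polyX_eq0.
  exact/prodf_neq0.
move=> r rm; rewrite fhatE /bin_transform mulr_sumr; apply: eq_bigr => k _.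
have km : (k < m.+1)%N by apply: leq_trans (ltn_ord k) _.
rewrite fl_npos addr0 (bigD1 (Ordinal km)) //= -/(D A B k).
rewrite -[rising (A - _) _]/(rising (A - m%:R) m.+1).
have -> : D A B 0 = rising (A - m%:R) m.+1 by rewrite /D mulr0 addr0.
by have := g k; move: (D A B k) => d d0; field.
Qed.

Lemma conclusion_npos A B (F : {fraction {poly C}}) : B != 0 -> good A B ->
  F = rcomp (block_poly (fhat (- m%:Z) A B) 0 m) (tofrac (1 - 'X) / tofrac 'X) ->
  [/\ exists2 d : R, 0 < d & forall y, cmod (y - 1) < d ->
        clim (fun N => \sum_(r < N) fhat (- m%:Z) A B r * ((1 - y) / y) ^+ r) (reval F y),
      exists M K1 : R, 0 <= K1 /\ forall r, cmod (fhat (- m%:Z) A B r) <= M * K1 ^+ r,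
      fl (- m%:Z) A B 0 = 1,
      forall p : option C, is_pole F p -> p = Some 0 &
      pole_order F (Some 0) = m].
Proof.
move=> B0 g FE; have top := fhat_npos_top g B0.
have sH := size_block_poly 0 top.
have XE : 'X = 1 *: ('X - 0%:P) :> {poly C} by rewrite scale1r subr0.
have sa : (size (1 - 'X : {poly C})%R <= 2)%N.
  by rewrite -size_polyN opprB -polyC1 size_XsubC.
have a0 : (1 - 'X : {poly C}).[0] != 0 by rewrite !hornerE subr0 oner_eq0.
have c0 : (1 : C) != 0 := oner_neq0 _.
rewrite [X in tofrac (1 - 'X) / tofrac X]XE in FE.
split.
- have [d d0 H] := small_quotient (lexx 0) (@ltr01 R).
  exists d => // y /H[y0 _]; rewrite FE (reval_mobius _ sH c0)//.
  rewrite scale1r subr0 !hornerE horner_block_poly.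
  apply: (clim_shift (m := m.+1)).
  rewrite (_ : (fun N => _) = fun=> \sum_(j < m.+1) fhat (- m%:Z) A B j * ((1 - y) / y) ^+ (0 + j)).
    exact: clim_cst.
  rewrite funeqE => N.
  apply: (sum_ord_trim (a := m.+1) (b := N + m.+1)
    (t := fun r => fhat (- m%:Z) A B r * ((1 - y) / y) ^+ r)) => [|j mj].
    exact: leq_addl.
  by rewrite (fhat_npos_gt g) ?mul0r.
- exists (\sum_(r < m.+1) cmod (fhat (- m%:Z) A B r)), 1; split => // r.
  rewrite expr1n mulr1; have [rm|mr] := leqP r m; last first.
    by rewrite (fhat_npos_gt g)// cmod0 sumr_ge0// => i _; apply: cmod_ge0.
  have rm' : (r < m.+1)%N by [].
  by rewrite (bigD1 (Ordinal rm')) //= lerDl sumr_ge0// => i _; apply: cmod_ge0.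
- by rewrite fl_npos mulr0 addr0 divff//; have := g 0%N; rewrite /D mulr0 addr0.
- by move=> p; rewrite FE => /(is_pole_mobius sH sa c0 a0).
- by rewrite FE (pole_order_mobius sH).
Qed.

End Nonpositive.

Section Positive.
Variable n : nat.

Let good A B := [/\ B != 0, B != 1 & rising (A + 1) n != 0].
Let w B : {poly C} := (1 - B) *: ('X - (B / (B - 1))%:P).

Let wE B : B != 1 -> w B = B%:P + (1 - B)%:P * 'X.
Proof.
move=> B1; rewrite /w -mul_polyC mulrBr -polyCM.
have -> : (1 - B) * (B / (B - 1)) = - B by field; rewrite subr_eq0.
by rewrite polyCN opprK addrC.
Qed.

Lemma fl_defined_pos A B : fl_defined n.+1%:Z A B -> rising (A + 1) n != 0.
Proof. by move=> [+ _] => /(_ isT); rewrite -[n.+1]addn1 PoszD addrK. Qed.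

Lemma uspec_binpoly (N : nat) (f : C -> C -> C) : upol f ->
  uspec (fun A B => binpoly N (f A B)).
Proof.
move=> uf; have := uspec_sum (n := N)
  (p := fun i A B => (cbin (f A B) i)%:P * 'X^i).
case=> [i|P PE]; first by apply: uspecM (uspec_cst _); apply: uspecC; apply: upol_cbin.
exists P => A B; rewrite PE /binpoly poly_def; apply: eq_bigr => i _.
by rewrite mul_polyC.
Qed.

Lemma uspec_tailpoly (N : nat) : uspec (fun A B : C => tailpoly B N).
Proof.
apply: uspecM; first exact: uspec_cst.
have := uspec_sum (n := N) (p := fun i (A B : C) => (cbin B i.+2)%:P * 'X^i).
case=> [i|P PE].
  by apply: uspecM (uspec_cst _); apply: uspecC; apply: upol_cbin; apply: upol_snd.
exists P => A B; rewrite PE poly_def; apply: eq_bigr => i _.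
by rewrite mul_polyC.
Qed.

Lemma upol_ccoef j : upol (fun A B => ccoef n A B j).
Proof.
apply: upol_coef; apply: uspecM; last exact: uspecX (uspec_tailpoly n).
by apply: uspec_binpoly; apply: upolD; [exact: upol_fst | exact: upol_cst].
Qed.

Lemma fraction_pos : exists P Q : {poly {poly {poly C}}}, forall A B, good A B ->
  spec2 Q A B != 0 /\ tofrac (spec2 P A B) / tofrac (spec2 Q A B) =
    rcomp (block_poly (hcoef n A B) n.+1 n) (tofrac 'X / tofrac (w B)).
Proof.
(* [w] is written with B / (B - 1), which is not polynomial in B; its expanded form is used here and
   [wE] returns to [w] at the end. *)
have [P [Q PQ]] : exists P Q : {poly {poly {poly C}}}, forall A B, good A B ->
    spec2 Q A B != 0 /\ tofrac (spec2 P A B) / tofrac (spec2 Q A B) =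
    rcomp (block_poly (hcoef n A B) n.+1 n)
      (tofrac 'X / tofrac (B%:P + (1 - B)%:P * 'X)).
  apply: (@uniform_fraction n.+1 n good (fun _ _ => 'X) (fun A B => B%:P + (1 - B)%:P * 'X)
    (fun j A B => hcoef n A B j)
    (fun i A B => (\sum_(j < n.+1 | (i <= j)%N) (-1) ^+ (j - i) * 'C(n + j, j - i)%:R *
       B ^+ (n - j) * ccoef n A B j) * ((i + n)`!%:R / i`!%:R))
    (fun A B => rising (A + 1) n * B ^+ n)).
  - exact: uspec_cst.
  - apply: uspecD; first by apply: uspecC; apply: upol_snd.
    apply: uspecM; last exact: uspec_cst.
    apply: uspecC; have := upolD (upol_cst 1) (upolM (upol_cst (-1)) (@upol_snd C)).
    by case=> P PE; exists P => A B; rewrite PE mulN1r.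
  - apply: upolM; last by apply: upolX; apply: upol_snd.
    by apply: upol_rising; apply: upolD; [exact: upol_fst | exact: upol_cst].
  - move=> i; apply: upolM; last exact: upol_cst.
    apply: upol_sum => j; apply: upolM; last exact: upol_ccoef.
    by apply: upolM; [exact: upol_cst | apply: upolX; apply: upol_snd].
  move=> A B [B0 B1 A0]; split.
  - rewrite -wE// scaler_eq0 negb_or polyXsubC_eq0 andbT.
    by rewrite subr_eq0 eq_sym.
  - by rewrite mulf_neq0 ?expf_neq0.
  move=> i _; rewrite /hcoef /gcoef.
  have -> : \sum_(j < n.+1 | (i <= j)%N) (-1) ^+ (j - i) * 'C(n + j, j - i)%:R *
       B ^+ (n - j) * ccoef n A B j = B ^+ n *
      \sum_(j < n.+1 | (i <= j)%N) (-1) ^+ (j - i) * 'C(n + j, j - i)%:R *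
       B^-1 ^+ j * ccoef n A B j.
    rewrite mulr_sumr; apply: eq_bigr => j _.
    have jn : (j <= n)%N by rewrite -ltnS.
    have -> : B ^+ n = B ^+ (n - j) * B ^+ j by rewrite -exprD subnK.
    by rewrite exprVn; field; rewrite expf_neq0.
  move: (\sum_(j < _ | _) _) => g.
  by field; rewrite A0 fact_neq0.
by exists P, Q => A B g; have [q0 ->] := PQ A B g; case: g => _ B1 _; rewrite wE.
Qed.

Lemma conclusion_pos A B (F : {fraction {poly C}}) : good A B ->
  F = rcomp (block_poly (hcoef n A B) n.+1 n) (tofrac 'X / tofrac (w B)) ->
  [/\ exists2 d : R, 0 < d & forall y, cmod (y - 1) < d ->
        clim (fun N => \sum_(r < N) fhat n.+1%:Z A B r * ((1 - y) / y) ^+ r) (reval F y),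
      exists M K1 : R, 0 <= K1 /\ forall r, cmod (fhat n.+1%:Z A B r) <= M * K1 ^+ r,
      fl n.+1%:Z A B 0 = 1,
      forall p : option C, is_pole F p -> p = Some (B / (B - 1)) &
      pole_order F (Some (B / (B - 1))) = (2 * n.+1 - 1)%N /\
      exists Ft : {fraction {poly C}}, F = iter n (@y2D C) Ft /\
        pole_order Ft (Some (B / (B - 1))) = n.+1].
Proof.
move=> [B0 B1 A0] FE; have top := hcoef_top B0 B1 A0.
have sH := size_block_poly n.+1 top.
have B1' : B - 1 != 0 by rewrite subr_eq0.
have c0 : 1 - B != 0 by rewrite subr_eq0 eq_sym.
have a0 : ('X : {poly C}).[B / (B - 1)] != 0.
  by rewrite hornerX mulf_neq0 ?invr_eq0.
have sa : (size ('X : {poly C})%R <= 2)%N by rewrite size_polyX.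
split.
- have [d d0 H] := small_quotient (cmod_ge0 B) (ltac:(lra) : 0 < 8^-1 :> R).
  exists d => // y /H[y0 By].
  pose t : C := (1 - y) / y; rewrite -/t; have ty : t * y = 1 - y by rewrite /t mulfVK.
  have t8 : cmod (- B * t) <= 8^-1 by rewrite cmodM cmodN.
  (* Hence v = y / w(y) is 1 / (1 + B t), and its powers are negative binomial series in - B t. *)
  have wy : (w B).[y] = y * (1 - - B * t).
    rewrite [RHS](_ : _ = y + B * (t * y)); last by ring.
    by rewrite ty wE// !hornerE; ring.
  have t1 : 1 - - B * t != 0.
    rewrite subr_eq0; apply: contraTneq t8 => <-.
    by rewrite cmod1 -ltNge invf_lt1// ltr1n.
  have yx0 : y != B / (B - 1).
    have : (w B).[y] != 0 by rewrite wy mulf_neq0.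
    by apply: contraNneq => ->; rewrite /w hornerZ hornerXsubC subrr mulr0.
  rewrite FE (reval_mobius _ sH c0)// -/(w B) wy hornerX.
  have -> : y / (y * (1 - - B * t)) = (1 - - B * t)^-1 by field; rewrite t1 y0.
  rewrite horner_block_poly.
  rewrite (_ : (fun N => _) = fun N => \sum_(i < n.+1) hcoef n A B i *
     \sum_(r < N) 'C(r + (n + i), n + i)%:R * (- B * t) ^+ r).
    apply: (@clim_sum R n.+1 (fun i N => hcoef n A B i *
      \sum_(r < N) 'C(r + (n + i), n + i)%:R * (- B * t) ^+ r)
      (fun i => hcoef n A B i * (1 - - B * t)^-1 ^+ (n.+1 + i))) => i.
    by apply: climZ; rewrite addSn; apply: clim_negative_binomial.
  rewrite funeqE => N; under [RHS]eq_bigr => i _ do rewrite mulr_sumr.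
  rewrite exchange_big; apply: eq_bigr => r _.
  rewrite fhat_pos// mulr_sumr mulr_suml; apply: eq_bigr => i _.
  rewrite -(bin_sub (leq_addl r (n + i))) addnK.
  by rewrite [(- B * t) ^+ r]exprMn; move: ((- B) ^+ r) => u; ring.
- exists (\sum_(i < n.+1) cmod (hcoef n A B i) * 2 ^+ (n + i)), (2 * cmod B).
  split; first by rewrite mulr_ge0 ?cmod_ge0.
  move=> r; rewrite fhat_pos// cmodM cmodX cmodN [leLHS]mulrC exprMn mulrA.
  apply: ler_wpM2r; rewrite ?exprn_ge0 ?cmod_ge0// mulr_suml.
  apply: le_trans (cmod_sum _ (fun i => hcoef n A B i * 'C(r + (n + i), r)%:R)) _.
  rewrite ler_sum// => i _; rewrite cmodM cmod_nat -mulrA ler_wpM2l ?cmod_ge0//.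
  by rewrite -exprD -natrX ler_nat addnC bin_le_exp2.
- by rewrite fl_pos mulr0 addr0 divff.
- by move=> p; rewrite FE => /(is_pole_mobius sH sa c0 a0).
split; first by rewrite FE (pole_order_mobius sH c0 a0); lia.
(* Division by the factor that n applications of y^2 D produce on v^(i+1). *)
pose g i := hcoef n A B i / (B ^+ n * ((i + n) ^_ n)%:R).
have g0 i : B ^+ n * ((i + n) ^_ n)%:R != 0 :> C.
  by rewrite mulf_neq0 ?expf_neq0// pnatr_eq0 -lt0n ffact_gt0 leq_addl.
have gn : g n != 0 by rewrite mulf_neq0// invr_eq0.
exists (rcomp (block_poly g 1 n) (tofrac 'X / tofrac (w B))); split; last first.
  by rewrite (pole_order_mobius (size_block_poly 1 gn) c0 a0).
have w0 : w B != 0 by rewrite scaler_eq0 negb_or c0 polyXsubC_eq0.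
have we : w B - 'X * (w B)^`() = B%:P.
  by rewrite wE// derivD derivC derivM derivC derivX; ring.
rewrite FE; have -> : block_poly g 1 n = \sum_(i < n.+1) g i *: 'X^(i.+1).
  by apply: eq_bigr => i _; rewrite add1n.
rewrite (iter_y2D_comp n g n.+1 w0 we); congr rcomp; apply: eq_bigr => i _.
by rewrite -mulrA /g mulfVK// [(i + n)%N]addnC addSn.
Qed.

End Positive.

End Assembly.

Unset Implicit Arguments.

Theorem theorem3p4 (R : realType) (l : int) :
  exists P Q : {poly {poly {poly (Cplx R)}}},
  forall A B : Cplx R, B != 0 -> B != 1 -> fl_defined l A B ->
  spec2 Q A B != 0 /\
  let F : {fraction {poly (Cplx R)}} :=
    tofrac (spec2 P A B) / tofrac (spec2 Q A B) in
  [/\ exists2 Y : Cplx R -> Cplx R, solution_near1 B Y &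
        \forall z \near (0 : Cplx R),
          (fun n : nat => 1 + \sum_(1 <= k < n)
             fl l A B k * cbin (A + B * k%:R) k * z ^+ k) @ \oo
          --> cpow (Y z) A * reval F (Y z),
      \forall y \near (1 : Cplx R),
        (fun n : nat => \sum_(0 <= r < n)
           fhat l A B r * ((1 - y) / y) ^+ r) @ \oo --> reval F y,
      forall p q : option (Cplx R), is_pole F p -> is_pole F q -> p = q,
      forall m : nat, (0 < m)%N -> l = - m%:Z ->
        pole_order F (Some 0) = m
    & forall n : nat, (0 < n)%N -> l = n%:Z ->
        pole_order F (Some (B / (B - 1))) = (2 * n - 1)%N /\
        exists Ft : {fraction {poly (Cplx R)}},
          F = iter (n - 1) (@y2D (Cplx R)) Ft /\
          pole_order Ft (Some (B / (B - 1))) = n].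
Proof.
(* l = 0 is treated as m = 0: F is then a constant without poles. *)
have [[n ->]|[m ->]] : (exists n : nat, l = n.+1%:Z) \/ (exists m : nat, l = - m%:Z).
- by case: l => [[|n]|m]; [right; exists 0%N | left; exists n | right; exists m.+1].
- have [P [Q PQ]] := fraction_pos R n; exists P, Q => A B B0 B1 def.
  have g := And3 B0 B1 (fl_defined_pos def); have [Q0 FE] := PQ A B g.
  split=> // F; have [hsum hb f0 pole poFt] := conclusion_pos g FE.
  split; [exact: series_in_z f0 hb hsum | exact: series_in_t hsum | | |].
  + by move=> p q /pole-> /pole->.
  + by move=> m m0 e; exfalso; lia.
  + by move=> k k0 [<-]; rewrite subSS subn0.
have [P [Q PQ]] := fraction_npos R m; exists P, Q => A B B0 B1 def.
have g := fl_defined_npos def; have [Q0 FE] := PQ A B g.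
split=> // F; have [hsum hb f0 pole po] := conclusion_npos B0 g FE.
split; [exact: series_in_z f0 hb hsum | exact: series_in_t hsum | | |].
+ by move=> p q /pole-> /pole->.
+ by move=> m' m'0 e; have <- : m = m' by lia.
+ by move=> k k0 e; exfalso; lia.
Qed.
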